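(* Let $n\ge 2$ and $d\ge 1$ be integers. Then $$\left(\frac{\mathrm{Vol}\, K'_{n,2d}}{\mathrm{Vol}\,\Sigma_H}\right)^{1/D_M}\ \ge\ \frac{2d}{9e^2\sqrt{2n\ln(2d+1)}}\,\sqrt{\frac{D_M}{D_{bi}}}.$$
   Context: $P_{n,2d}$ is the real vector space of forms (homogeneous polynomials) of degree $2d$ in $n$ variables. $\sigma$ denotes the rotation-invariant probability measure on the unit sphere $\mathbb{S}^{n-1}\subset\mathbb{R}^n$, and also the corresponding product probability measure on $\mathbb{S}^{n-1}\times\mathbb{S}^{n-1}$. $M_{n,2d}=\{p\in P_{n,2d}: \int_{\mathbb{S}^{n-1}} p\,d\sigma=0\}$, $D_M=\dim M_{n,2d}=\binom{n+2d-1}{2d}-1$, and $M'_{n,2d}=\{p\in P_{n,2d}: \int_{\mathbb{S}^{n-1}} p\,d\sigma=1\}$ is the parallel affine hyperplane. $K'_{n,2d}=\{p\in M'_{n,2d} : p \text{ is a convex function on } \mathbb{R}^n\}$. For $p\in P_{n,2d}$ let $H_p(x)=\left(\frac{\partial^2 p}{\partial x_i\partial x_j}(x)\right)_{i,j}$ be the Hessian and let $B_p(x,y)=y^TH_p(x)y$. The Hessian inner product on $P_{n,2d}$ is $$\langle p,q\rangle_H=\int_{\mathbb{S}^{n-1}\times\mathbb{S}^{n-1}}B_pB_q\,d\sigma .$$ $\Sigma_H=\{p\in M_{n,2d}:\langle p,p\rangle_H\le 1\}$ is the unit ball of the Hessian inner product. Volumes are $D_M$-dimensional Lebesgue volumes,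 normalized in the same way on $M_{n,2d}$ and on its translate $M'_{n,2d}$. $D_{bi}=\binom{n+2d-3}{2d-2}\binom{n+1}{2}$ (the dimension of the space of forms in $(x,y)\in\mathbb{R}^n\times\mathbb{R}^n$ that are homogeneous of degree $2d-2$ in $x$ and of degree $2$ in $y$). *)

(* Defs.v *)
(* mpoly is imported without its notations, which clash with those of
   MathComp-Analysis. *)
From HB Require Import structures.
From mathcomp Require Import all_boot all_order all_algebra.
From mathcomp Require Import all_classical all_reals all_analysis.
From mathcomp Require Import -(notations) mpoly.

Set Implicit Arguments.
Unset Strict Implicit.
Unset Printing Implicit Defensive.

Import Order.TTheory GRing.Theory Num.Theory.
Import numFieldNormedType.Exports.

Local Open Scope classical_set_scope.
Local Open Scope ring_scope.

(* Column vectors with the Borel sigma-algebra. *)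
Definition borelRn (R : realType) (n : nat) :=
  g_sigma_algebraType (@open 'cV[R]_n).

(* The Euclidean sphere (the library norm on matrices is the sup norm). *)
Definition unit_sphere (R : realType) (n : nat) : set (borelRn R n) :=
  [set x : 'cV[R]_n | \sum_i x i 0 ^+ 2 = 1].

Arguments unit_sphere R n : clear implicits.

Definition is_rotation (R : realType) (n : nat) (Q : 'M[R]_n) : Prop :=
  Q^T *m Q = 1%:M /\ \det Q = 1.

(* A probability measure on S^(n-1) is represented by a Borel probability
   measure on R^n giving full mass to the sphere. *)
Definition rotation_invariant_on_sphere (R : realType) (n : nat)
    (sigma : probability (borelRn R n) R) : Prop :=
  sigma (unit_sphere R n) = 1%E /\
  forall Q : 'M[R]_n, is_rotation Q ->
  forall A : set (borelRn R n), measurable A ->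
    sigma [set x : 'cV[R]_n | A (Q *m x)] = sigma A.

Section Forms.
Variables (R : realType) (n d : nat).

Definition forms : lmodType R := dhomog n R (2 * d).

Definition form_eval (p : forms) (x : 'cV[R]_n) : R :=
  meval (fun i => x i 0) (mpoly_of_dhomog p).

Definition hessian (p : forms) (x : 'cV[R]_n) : 'M[R]_n :=
  \matrix_(i, j) meval (fun k => x k 0)
    (mderiv i (mderiv j (mpoly_of_dhomog p))).

Definition hessian_form (p : forms) (x y : 'cV[R]_n) : R :=
  (y^T *m hessian p x *m y) 0 0.

Definition dim_mean_zero : nat := ('C(n + 2 * d - 1, 2 * d) - 1)%N.

Definition dim_biforms : nat := ('C(n + 2 * d - 3, 2 * d - 2) * 'C(n + 1, 2))%N.

Variable sigma : probability (borelRn R n) R.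

Definition sphere_mean (p : forms) : R :=
  \int[sigma]_(x in unit_sphere R n) form_eval p x.

Definition mean_zero_forms : set forms := [set p | sphere_mean p = 0].

Definition mean_one_forms : set forms := [set p | sphere_mean p = 1].

Definition hessian_prod (p q : forms) : R :=
  \int[(sigma \x sigma)%E]_(z in unit_sphere R n `*` unit_sphere R n)
    (hessian_form p z.1 z.2 * hessian_form q z.1 z.2).

Definition hessian_ball : set forms :=
  [set p | mean_zero_forms p /\ hessian_prod p p <= 1].

Definition convex_forms : set forms :=
  [set p | mean_one_forms p /\
    convex_function (setT : set (convex_lmodType 'cV[R]_n)) (form_eval p)].

End Forms.

Arguments mean_zero_forms {R n} d sigma.
Arguments mean_one_forms {R n} d sigma.
Arguments hessian_ball {R n} d sigma.
Arguments convex_forms {R n} d sigma.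

(* D-dimensional Lebesgue measure on coordinate tuples, as the iterated product
   of the one-dimensional one; only its values on Borel sets are meaningful. *)
Fixpoint lebesgue_tuple (R : realType) (D : nat) :
    set (D.-tuple R) -> \bar R :=
  match D return set (D.-tuple R) -> \bar R with
  | 0%N => fun A => (\1_A [tuple])%:E
  | D'.+1 => fun A =>
      (\int[@lebesgue_measure R]_x
         lebesgue_tuple [set t : D'.-tuple R | A [tuple of x :: t]])%E
  end.

Definition lincomb (R : realType) (V : lmodType R) (D : nat)
    (e : 'I_D -> V) (t : D.-tuple R) : V := \sum_(i < D) tnth t i *: e i.

Definition is_basis (R : realType) (V : lmodType R) (D : nat)
    (M : set V) (e : 'I_D -> V) : Prop :=
  injective (lincomb e) /\ range (lincomb e) = M.

(* Lebesgue volume on the affine space p0 + span e, normalized so that the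
   parallelepiped spanned by e has volume 1. *)
Definition volume (R : realType) (V : lmodType R) (D : nat)
    (e : 'I_D -> V) (p0 : V) (A : set V) : R :=
  fine (lebesgue_tuple [set t : D.-tuple R | A (p0 + lincomb e t)]).

(* Main.v *)
Require Import Defs.
From HB Require Import structures.
From mathcomp Require Import all_boot all_order all_algebra.
From mathcomp Require Import all_classical all_reals all_analysis.
From mathcomp Require Import -(notations) mpoly.
From mathcomp Require Import measurable_realfun.
From mathcomp Require Import ring lra zify.

Set Implicit Arguments.
Unset Strict Implicit.
Unset Printing Implicit Defensive.

Import Order.TTheory GRing.Theory Num.Theory.
Import numFieldNormedType.Exports.

Local Open Scope classical_set_scope.
Local Open Scope ring_scope.

(** Fix the form |x|^(2d), which has mean 1 and whose Hessian form is at least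
    2d on pairs of unit vectors. Adding to it a form p of mean zero whose
    Hessian form B_p is at most 2d in absolute value on pairs of unit vectors
    gives a convex form of mean 1. So, up to translation, the set of convex
    forms of mean 1 contains the forms of mean zero with sup |B_p| <= 2d
    (convex_near_radial), and the task is to bound from below the volume of
    this set relative to the unit ball of the Hessian norm.

    The sup norm is first replaced by an L^(2k) norm. On the sphere, a form f
    of degree a satisfies f(x)^2 <= N * int f^2 with N the dimension of the
    space of forms of degree a: the reproducing kernel is constant on the
    diagonal by rotation invariance, and its integral there is N
    (homogeneous_sup_bound, form_sup_bound). Applied to B_p^k in each of its two
    variables this gives sup B_p^(2k) <= N_k * int B_p^(2k) with N_k the
    dimension of a space of biforms (hess_power_bound); for k of order
    n ln(2d + 1) the factor N_k is only exponential in k (biform_dim_le). For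
    k = 1 it says that evaluation of B_p at a pair of unit vectors is a linear
    form in p of Hessian norm at most sqrt(D_bi) (hess_sup_bound).

    To bound the volume of the set where int B_p^(2k) is small, weight the space
    of forms of mean zero by the Gaussian exp(- c <p, p>_H) with c = D_M / 2.
    Completing the square gives the exponential moments of a linear form, hence
    its moment of order 2k, and averaging over pairs of unit vectors gives the
    mean of int B_p^(2k) (gaussian_moment, gaussian_power_integral). By Markov's
    inequality the set where this quantity is at most twice its mean carries at
    least half of the Gaussian mass, so its volume is at least e^(-c) / 2 times that
    of the unit ball (power_sublevel_volume). A dilation brings this set into
    the region sup |B_p| <= 2d, and only the constants remain to be compared
    (numeric_bound, root_lower_bound).

    Volumes being iterated integrals, the argument only uses monotonicity,
    Tonelli's theorem, and the effect of translations and dilations on them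
    (iint_affine). The division and the root are meaningful because the unit
    ball has positive finite volume and the convex forms of mean 1 have finite
    volume: being nonnegative, they are bounded in L2 norm
    (convex_forms_volume_fin). *)

(** * Affine changes of variable on the line *)

Section AffineChange.
Context {R : realType}.
Local Notation Rm := (measurableTypeR R).
Local Notation leb := (@lebesgue_measure R).
Variables (s a : R) (s0 : 0 < s).
Let phi : Rm -> Rm := fun x : R => a + s * x.

Lemma measurable_affine : measurable_fun setT phi.
Proof.
apply: (@measurable_funD _ Rm R setT (cst a) (fun x => s * x)).
  exact: measurable_cst.
exact: (@mulrl_measurable R setT s).
Qed.

Let phiM := measurable_affine.

Let pushM : {measure set Rm -> \bar R} :=
  measure_function_pushforward__canonical__measure_function_Measure leb phiM.

(** Uniqueness of Lebesgue measure: s times the image measure agrees with it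
    on half-open intervals. *)
Lemma lebesgue_affine (A : set Rm) : measurable A ->
  (leb (phi @^-1` A) = (s^-1)%:E * leb A)%E.
Proof.
move=> mA.
have sge : 0 <= s by exact: ltW.
pose nu : {measure set Rm -> \bar R} := mscale (NngNum sge) pushM.
have := @lebesgue_measure_unique R nu.
move=> /(_ _ _ mA) ->; last first.
  move=> _ [[p q] /= pq <-].
  rewrite /nu /mscale /= /pushforward.
  have -> : phi @^-1` `]p, q] = `](p - a) / s, (q - a) / s]%classic.
    apply/seteqP; split => x /=; rewrite !in_itv /= ltr_pdivrMr// ler_pdivlMr// /phi.
      by move=> /andP[? ?]; apply/andP; split; lra.
    by move=> /andP[? ?]; apply/andP; split; lra.
  rewrite !lebesgue_measure_itv/= !lte_fin ltr_pM2r ?invr_gt0// ltrD2r.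
  case: ifP => pq'; rewrite ?mule0// -EFinB -EFinM; congr (_%:E).
  by field; rewrite gt_eqF.
rewrite /nu /mscale /= muleA -EFinM mulVf ?mul1e ?gt_eqF//.
Qed.

Lemma ge0_integral_affine (f : Rm -> \bar R) :
  measurable_fun setT f -> (forall x, (0 <= f x)%E) ->
  (\int[leb]_x f (phi x) = (s^-1)%:E * \int[leb]_x f x)%E.
Proof.
move=> mf f0.
have si : 0 <= s^-1 by rewrite invr_ge0 ltW.
have := @ge0_integral_pushforward _ _ _ _ R phi phiM leb setT f measurableT mf
  (fun x _ => f0 x).
rewrite preimage_setT => <-.
rewrite -(ge0_integral_mscale _ measurableT (NngNum si))//.
by apply: eq_measure_integral => A mA _ /=; rewrite /mscale /= -lebesgue_affine.
Qed.

End AffineChange.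

(** * Iterated integrals over tuples *)

Section IteratedIntegral.
Context {R : realType}.
Local Notation Rm := (measurableTypeR R).
Local Notation leb := (@lebesgue_measure R).
Local Open Scope ereal_scope.

(** Integrals of functions obey linearity, Tonelli and monotonicity, which
    the set function lebesgue_tuple does not express; the recursion mirrors
    that of lebesgue_tuple so that the two agree on indicators. *)
Fixpoint iint (D : nat) : (D.-tuple Rm -> \bar R) -> \bar R :=
  match D return (D.-tuple Rm -> \bar R) -> \bar R with
  | 0%N => fun f => f [tuple]
  | D'.+1 => fun f => \int[leb]_x iint (fun t : D'.-tuple Rm => f [tuple of x :: t])
  end.

Lemma lebesgue_tuple_iint D (A : set (D.-tuple R)) :
  lebesgue_tuple A = iint (fun t => (\1_A t)%:E).
Proof.
elim: D A => [//|D IH] A /=.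
by apply: eq_integral => x _; rewrite IH.
Qed.

Lemma iint_ge0 D (f : D.-tuple Rm -> \bar R) : (forall t, 0 <= f t) -> 0 <= iint f.
Proof.
elim: D f => [|D IH] f f0 /=; first exact: f0.
by apply: integral_ge0 => x _; apply: IH => t; exact: f0.
Qed.

(** The integral of a nonnegative function is a supremum over the simple
    functions below it, whence monotonicity for arbitrary functions; the
    volume of the set of convex forms is compared to others through it. *)
Lemma le_ge0_integral d (T : measurableType d) (mu : {measure set T -> \bar R})
  (f g : T -> \bar R) : (forall x, 0 <= f x) -> (forall x, f x <= g x) ->
  \int[mu]_x f x <= \int[mu]_x g x.
Proof.
move=> f0 fg.
have g0 x : 0 <= g x by apply: le_trans (fg x).
rewrite !ge0_integralE// !patch_setT; apply: le_ereal_sup => _ [h hf <-].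
by exists h => // x; apply: le_trans (hf x) (fg x).
Qed.

Lemma le_iint D (f g : D.-tuple Rm -> \bar R) :
  (forall t, 0 <= f t) -> (forall t, f t <= g t) -> iint f <= iint g.
Proof.
elim: D f g => [|D IH] f g f0 fg /=; first exact: fg.
apply: le_ge0_integral => x; first by apply: iint_ge0 => t; exact: f0.
by apply: IH => t; [exact: f0|exact: fg].
Qed.

Lemma eq_iint D (f g : D.-tuple Rm -> \bar R) : f =1 g -> iint f = iint g.
Proof. by move=> /funext ->. Qed.

(** The induction needs an arbitrary parameter space S: peeling off one
    coordinate moves it into the parameter. *)
Lemma measurable_iint d (S : measurableType d) D (g : S * D.-tuple Rm -> \bar R) :
  measurable_fun setT g -> (forall z, 0 <= g z) ->
  measurable_fun setT (fun s => iint (fun t => g (s, t))).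
Proof.
elim: D d S g => [|D IH] d S g mg g0 /=.
  apply: (measurableT_comp mg); exact: measurable_fun_pair.
pose h (z : S * Rm) := iint (fun t : D.-tuple Rm => g (z.1, [tuple of z.2 :: t])).
have mh : measurable_fun setT h.
  apply: (IH _ _ (fun w => g (w.1.1, [tuple of w.1.2 :: w.2]))) => //.
  apply: measurableT_comp => //=; apply: measurable_fun_pair => /=.
    exact: measurableT_comp.
  by apply: measurable_cons => //; exact: measurableT_comp.
apply: (@measurable_fun_fubini_tonelli_F _ _ S Rm R leb h) => //.
by move=> z; apply: iint_ge0.
Qed.

Lemma measurable_iint_cons D (f : D.+1.-tuple Rm -> \bar R) :
  measurable_fun setT f -> (forall t, 0 <= f t) ->
  measurable_fun setT (fun x : Rm => iint (fun t => f [tuple of x :: t])).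
Proof.
move=> mf f0.
apply: (@measurable_iint _ _ _ (fun w : Rm * D.-tuple Rm => f [tuple of w.1 :: w.2])) => //.
by apply: measurableT_comp => //; exact: measurable_cons.
Qed.

Lemma measurable_cons_slice D (f : D.+1.-tuple Rm -> \bar R) (x : Rm) :
  measurable_fun setT f -> measurable_fun setT (fun t : D.-tuple Rm => f [tuple of x :: t]).
Proof. by move=> mf; apply: measurableT_comp => //; apply: measurable_cons. Qed.

Lemma iintZl D (k : R) (f : D.-tuple Rm -> \bar R) :
  measurable_fun setT f -> (forall t, 0 <= f t) -> (0 <= k)%R ->
  iint (fun t => k%:E * f t) = k%:E * iint f.
Proof.
move=> + + k0; elim: D f => [//|D IH] f mf f0 /=.
rewrite -ge0_integralZl_EFin//; first last.
- exact: measurable_iint_cons.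
- by move=> x _; exact: iint_ge0.
by apply: eq_integral => x _; rewrite IH//; exact: measurable_cons_slice.
Qed.

Lemma iintD D (f g : D.-tuple Rm -> \bar R) :
  measurable_fun setT f -> (forall t, 0 <= f t) ->
  measurable_fun setT g -> (forall t, 0 <= g t) ->
  iint (fun t => f t + g t) = iint f + iint g.
Proof.
elim: D f g => [//|D IH] f g mf f0 mg g0 /=.
rewrite -ge0_integralD//.
- by apply: eq_integral => x _; rewrite IH//; exact: measurable_cons_slice.
- by move=> x _; exact: iint_ge0.
- exact: measurable_iint_cons.
- by move=> x _; exact: iint_ge0.
- exact: measurable_iint_cons.
Qed.

Definition affine_tuple (s : R) D (a t : D.-tuple R) : D.-tuple R :=
  [tuple (tnth a i + s * tnth t i)%R | i < D].

Lemma affine_tuple_cons s D (a : D.+1.-tuple R) x (t : D.-tuple R) :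
  affine_tuple s a [tuple of x :: t] =
  [tuple of (thead a + s * x)%R :: affine_tuple s [tuple of behead a] t].
Proof.
apply: eq_from_tnth => i; rewrite tnth_mktuple.
have [j ->|->] := unliftP ord0 i.
  by rewrite !tnthS tnth_mktuple [in LHS](tuple_eta a) tnthS.
by rewrite !tnth0 /thead.
Qed.

Lemma iint_affine D (s : R) (a : D.-tuple Rm) (f : D.-tuple Rm -> \bar R) :
  (0 < s)%R -> measurable_fun setT f -> (forall t, 0 <= f t) ->
  iint (fun t => f (affine_tuple s a t)) = ((s ^+ D)^-1)%:E * iint f.
Proof.
move=> s0; elim: D a f => [|D IH] a f mf f0 /=.
  by rewrite expr0 invr1 mul1e; congr f; apply: eq_from_tnth; case.
have sD : (0 <= (s ^+ D)^-1)%R by rewrite invr_ge0 exprn_ge0// ltW.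
transitivity (\int[leb]_x (((s ^+ D)^-1)%:E *
    iint (fun t => f [tuple of (thead a + s * x)%R :: t]))).
  apply: eq_integral => x _.
  rewrite -(IH [tuple of behead a] (fun t => f [tuple of (thead a + s * x)%R :: t]))//;
    last exact: measurable_cons_slice.
  by apply: eq_iint => t; rewrite affine_tuple_cons.
have mi := measurable_iint_cons mf f0.
have := @ge0_integral_affine R s (thead a) s0 _ mi (fun x => iint_ge0 (fun t => f0 _)).
rewrite ge0_integralZl_EFin//; first last.
- apply: (measurableT_comp mi); exact: measurable_affine.
- by move=> x _; apply: iint_ge0.
by move=> ->; rewrite exprS invfM EFinM -[RHS]muleA muleCA.
Qed.

Lemma iint_tonelli d (S : measurableType d) (mu : {sigma_finite_measure set S -> \bar R}) D
  (g : S * D.-tuple Rm -> \bar R) :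
  measurable_fun setT g -> (forall z, 0 <= g z) ->
  iint (fun t => \int[mu]_s g (s, t)) = \int[mu]_s iint (fun t => g (s, t)).
Proof.
elim: D g => [//|D IH] g mg g0 /=.
pose h (z : S * Rm) := iint (fun t : D.-tuple Rm => g (z.1, [tuple of z.2 :: t])).
have mh : measurable_fun setT h.
  apply: (@measurable_iint _ _ _
    (fun w : (S * Rm) * D.-tuple Rm => g (w.1.1, [tuple of w.1.2 :: w.2]))) => //.
  apply: measurableT_comp => //=; apply: measurable_fun_pair => /=.
    exact: measurableT_comp.
  by apply: measurable_cons => //; exact: measurableT_comp.
rewrite (@fubini_tonelli _ _ S Rm R mu leb h)//; last by move=> z; exact: iint_ge0.
apply: eq_integral => x _.
rewrite (IH (fun z => g (z.1, [tuple of x :: z.2])))//.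
apply: measurableT_comp => //=; apply: measurable_fun_pair => //=.
by apply: measurable_cons => //; exact: measurableT_comp.
Qed.

Lemma measurable_prod_tnth D (f : Rm -> R) : measurable_fun setT f ->
  measurable_fun setT (fun t : D.-tuple Rm => \prod_(i < D) f (tnth t i))%R.
Proof.
move=> mf; apply: measurable_prod => i _.
apply: measurableT_comp => //; exact: measurable_tnth.
Qed.

(** Gives both the volume of a cube and the finiteness of Gaussian integrals. *)
Lemma iint_prod D (f : Rm -> R) : measurable_fun setT f -> (forall x, 0 <= f x)%R ->
  iint (fun t : D.-tuple Rm => (\prod_(i < D) f (tnth t i))%:E) =
  (\int[leb]_x (f x)%:E) ^+ D.
Proof.
move=> mf f0; elim: D => [|D IH] /=; first by rewrite big_ord0.
under eq_integral => x _.
  under eq_iint => t.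
    rewrite big_ord_recl tnth0 EFinM.
    under eq_bigr do rewrite tnthS.
    over.
  rewrite iintZl//; last 2 first.
  - by apply/measurable_EFinP; exact: measurable_prod_tnth.
  - by move=> t; rewrite lee_fin; apply: prodr_ge0.
  rewrite IH; over.
rewrite ge0_integralZr//.
- by rewrite -[RHS]/(_ ^+ D.+1) expeS.
- exact: (measurableT_comp (@EFin_measurable R setT) mf).
- by move=> x _; rewrite lee_fin.
- by apply: expe_ge0; apply: integral_ge0 => x _; rewrite lee_fin.
Qed.

End IteratedIntegral.

(** * Positive definite quadratic forms *)

Section QuadraticForm.
Context {R : realType} {D : nat}.
Implicit Types (G : 'M[R]_D) (v w : 'rV[R]_D).

Definition bilin G v w : R := (v *m G *m w^T) 0 0.

Lemma bilinDl G v w x : bilin G (v + w) x = bilin G v x + bilin G w x.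
Proof. by rewrite /bilin !mulmxDl mxE. Qed.

Lemma bilinDr G v w x : bilin G x (v + w) = bilin G x v + bilin G x w.
Proof. by rewrite /bilin linearD /= mulmxDr mxE. Qed.

Lemma bilinZl G a v x : bilin G (a *: v) x = a * bilin G v x.
Proof. by rewrite /bilin -!scalemxAl mxE. Qed.

Lemma bilinZr G a v x : bilin G x (a *: v) = a * bilin G x v.
Proof. by rewrite /bilin linearZ /= -scalemxAr mxE. Qed.

Lemma bilinC G v w : G^T = G -> bilin G v w = bilin G w v.
Proof.
move=> sG; rewrite /bilin -[in LHS](trmxK v) -[in LHS]sG -trmx_mul -trmx_mul.
by rewrite mxE mulmxA.
Qed.

Lemma bilinE G v w : bilin G v w = \sum_i \sum_j v 0 i * G i j * w 0 j.
Proof.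
rewrite /bilin mxE exchange_big /=; apply: eq_bigr => j _.
by rewrite !mxE big_distrl.
Qed.

Lemma bilin_cauchy_schwarz G v w : G^T = G -> (forall x, 0 <= bilin G x x) ->
  bilin G v w ^+ 2 <= bilin G v v * bilin G w w.
Proof.
move=> sG G0.
have H a b : 0 <= a ^+ 2 * bilin G v v + 2 * a * b * bilin G v w + b ^+ 2 * bilin G w w.
  have := G0 (a *: v + b *: w).
  rewrite !(bilinDl, bilinDr, bilinZl, bilinZr) (bilinC w v sG).
  by move=> /le_trans; apply; lra.
have := H (bilin G w w) (- bilin G v w).
(* When w is null for G, this choice of coefficients leaves -(v . w)^2 >= 0. *)
have := H (bilin G v w) (- (bilin G v v + 1) / 2).
have := G0 w.
set p := bilin G v v; set q := bilin G w w; set r := bilin G v w => q0 H1 H2.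
have [q00|qn0] := eqVneq q 0.
  by rewrite q00 in H1 *; rewrite mulr0; move: H1; lra.
have {}q0 : 0 < q by rewrite lt_neqAle eq_sym qn0.
have : 0 <= q * (p * q - r ^+ 2) by move: H2; lra.
by rewrite pmulr_rge0// subr_ge0.
Qed.

Definition posdef G := G^T = G /\ forall v, v != 0 -> 0 < bilin G v v.

Lemma posdef_ge0 G v : posdef G -> 0 <= bilin G v v.
Proof.
move=> [_ H]; have [->|/H/ltW//] := eqVneq v 0.
by rewrite /bilin !mul0mx mxE.
Qed.

Lemma posdef_unit G : posdef G -> G \in unitmx.
Proof.
move=> [_ H]; rewrite -row_free_unit -kermx_eq0.
apply/eqP/row_matrixP => i; rewrite row0; apply/eqP/negPn/negP => /H.
have /sub_kermxP : (row i (kermx G) <= kermx G)%MS by exact: row_sub.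
by rewrite /bilin => ->; rewrite mul0mx mxE ltxx.
Qed.

(** The representer, for the inner product of G, of the linear form given by
    pairing with b. *)
Definition riesz G (b : 'rV[R]_D) := b *m invmx G.

Lemma rieszE G b v : posdef G -> bilin G v (riesz G b) = (v *m b^T) 0 0.
Proof.
move=> pG; have [sG _] := pG.
rewrite /bilin /riesz trmx_mul trmx_inv sG !mulmxA mulmxK//.
exact: posdef_unit.
Qed.

(** Each coordinate is a linear form, so Cauchy-Schwarz against its
    representer bounds its square by a multiple of the quadratic form; this
    replaces a compactness argument on the unit sphere. *)
Lemma posdef_lower G : posdef G ->
  exists2 e : R, 0 < e & forall v, e * \sum_i v 0 i ^+ 2 <= bilin G v v.
Proof.
move=> pG; have [sG _] := pG.
pose C := \sum_(i < D) bilin G (riesz G (delta_mx 0 i)) (riesz G (delta_mx 0 i)).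
have C0 : 0 <= C by apply: sumr_ge0 => i _; exact: posdef_ge0.
exists (C + 1)^-1; first by rewrite invr_gt0; lra.
move=> v; rewrite mulrC ler_pdivrMr; last by lra.
apply: (@le_trans _ _ (bilin G v v * C)); last first.
  by rewrite ler_wpM2l ?posdef_ge0//; lra.
rewrite /C mulr_sumr; apply: ler_sum => i _.
apply: le_trans (bilin_cauchy_schwarz _ _ sG (fun x => posdef_ge0 x pG)).
by rewrite rieszE// trmx_delta -colE mxE.
Qed.

Lemma bilin_upper G : exists2 C : R, 0 < C &
  forall v, bilin G v v <= C * \sum_i v 0 i ^+ 2.
Proof.
exists (\sum_i \sum_j `|G i j| + 1).
  by apply: ltr_wpDl => //; apply: sumr_ge0 => i _; exact: sumr_ge0.
move=> v; rewrite bilinE.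
set S := \sum_i v 0 i ^+ 2.
have vS i : v 0 i ^+ 2 <= S.
  rewrite /S (bigD1 i)//= lerDl; apply: sumr_ge0 => j _; exact: sqr_ge0.
have S0 : 0 <= S by apply: sumr_ge0 => i _; exact: sqr_ge0.
rewrite mulrDl mul1r; apply: ler_wpDr => //.
rewrite mulr_suml; apply: ler_sum => i _.
rewrite mulr_suml; apply: ler_sum => j _.
rewrite mulrAC mulrC.
apply: le_trans (ler_norm _) _; rewrite normrM ler_wpM2l//.
rewrite ler_norml; have := vS i; have := vS j; nra.
Qed.

End QuadraticForm.

(** * Gaussian weights and their moments *)

Section Gaussian.
Context {R : realType} {D : nat}.
Local Notation Rm := (measurableTypeR R).
Local Notation leb := (@lebesgue_measure R).
Local Notation T := (D.-tuple Rm).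

Definition rowv (t : D.-tuple R) : 'rV[R]_D := \row_i tnth t i.

Lemma rowv_affine s (a t : D.-tuple R) : rowv (affine_tuple s a t) = rowv a + s *: rowv t.
Proof. by apply/rowP => i; rewrite !mxE tnth_mktuple. Qed.

Lemma rowv_surj v : exists t, rowv t = v.
Proof. by exists [tuple v 0 i | i < D]; apply/rowP => i; rewrite mxE tnth_mktuple. Qed.

Lemma measurable_bilin (G : 'M[R]_D) :
  measurable_fun setT (fun t : T => bilin G (rowv t) (rowv t)).
Proof.
rewrite (_ : (fun _ => _) = fun t : T => \sum_i \sum_j tnth t i * G i j * tnth t j); last first.
  by apply/funext => t; rewrite bilinE; apply: eq_bigr => i _; apply: eq_bigr => j _; rewrite !mxE.
apply: measurable_sum => i; apply: measurable_sum => j.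
apply: (@measurable_funM _ T R setT); last exact: measurable_tnth.
apply: (@measurable_funM _ T R setT); last exact: measurable_cst.
exact: measurable_tnth.
Qed.

Lemma measurable_affine_tuple s (a : T) : measurable_fun setT (affine_tuple s a : T -> T).
Proof.
apply/measurable_fun_tnthP => i.
rewrite (_ : _ \o _ = fun t : T => tnth a i + s * tnth t i); last first.
  by apply/funext => t /=; rewrite tnth_mktuple.
exact: (measurableT_comp (@measurable_affine R s (tnth a i)) (measurable_tnth i)).
Qed.

Lemma gauss_integrable (e : R) : 0 < e ->
  (\int[leb]_x (expR (- (e * x ^+ 2)))%:E < +oo)%E.
Proof.
move=> e0; have se : 0 < Num.sqrt e by rewrite sqrtr_gt0.
rewrite (eq_integral (fun x : Rm => (gauss_fun (0 + Num.sqrt e * x))%:E)); last first.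
  by move=> x _; rewrite /gauss_fun add0r exprMn sqr_sqrtr// ltW.
rewrite (@ge0_integral_affine R _ 0 se (fun x => (gauss_fun x)%:E)).
- by rewrite integralT_gauss -EFinM ltry.
- exact: (measurableT_comp (@EFin_measurable R setT) (@measurable_gauss_fun R)).
- by move=> x; rewrite lee_fin gauss_fun_ge0.
Qed.

Variables (G : 'M[R]_D) (pG : posdef G).
Let Q (t : D.-tuple R) := bilin G (rowv t) (rowv t).

Definition gaussian c (t : T) : R := expR (- (c * Q t)).

Lemma measurable_gaussian c : measurable_fun setT (gaussian c).
Proof.
rewrite (_ : gaussian c = expR \o (fun t => - c * Q t)); last first.
  by apply/funext => t; rewrite /gaussian /= mulNr.
apply: (measurableT_comp (@measurable_expR R)).
apply: (@measurable_funM _ T R setT); first exact: measurable_cst.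
exact: measurable_bilin.
Qed.

(** The Gaussian is dominated by a product of one-variable Gaussians, since
    the form dominates a multiple of the Euclidean one. *)
Lemma gaussian_fin c : 0 < c -> (iint (fun t => (gaussian c t)%:E) < +oo)%E.
Proof.
move=> c0; have [e e0 He] := posdef_lower pG.
pose g (x : Rm) : R := expR (- ((c * e) * x ^+ 2)).
have mg : measurable_fun setT g.
  rewrite (_ : g = expR \o (fun x : Rm => - (c * e) * x ^+ 2)); last first.
    by apply/funext => x; rewrite /g /= mulNr.
  apply: (measurableT_comp (@measurable_expR R)).
  apply: (@measurable_funM _ Rm R setT); first exact: measurable_cst.
  exact: exprn_measurable.
apply: (@le_lt_trans _ _ (iint (fun t : T => (\prod_(i < D) g (tnth t i))%:E))).
  apply: le_iint => t; first by rewrite lee_fin expR_ge0.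
  rewrite lee_fin /g -expR_sum ler_expR sumrN lerN2 -mulr_sumr -mulrA (ler_wpM2l (ltW c0))//.
  by apply: le_trans (He _); rewrite (ler_wpM2l (ltW e0))//; apply: ler_sum => i _; rewrite mxE.
rewrite iint_prod// => [|x]; last exact: expR_ge0.
have I0 : (0 <= \int[leb]_x (g x)%:E)%E by apply: integral_ge0 => x _; rewrite lee_fin expR_ge0.
rewrite -ge0_fin_numE ?expe_ge0// fin_numX// ge0_fin_numE//.
by apply: gauss_integrable; exact: mulr_gt0.
Qed.

(** Completing the square: multiplying the Gaussian by the exponential of a
    linear form is a translation of the Gaussian, up to a factor depending on
    the norm of the form, which is at most the square root of M. *)
Lemma gaussian_mgf c (u : R) (b : 'rV[R]_D) (M : R) : 0 < c -> 0 <= M ->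
  (forall v, ((v *m b^T) 0 0) ^+ 2 <= M * bilin G v v) ->
  (iint (fun t : T => (expR (u * (rowv t *m b^T) 0%R 0%R) * gaussian c t)%:E)
   <= (expR (u ^+ 2 * M / (4 * c)))%:E * iint (fun t : T => (gaussian c t)%:E))%E.
Proof.
move=> c0 M0 bM.
set a := riesz G b; have [sG _] := pG.
have aM : bilin G a a <= M.
  have := bM a; rewrite -(rieszE b a pG) -/a => H.
  have := posdef_ge0 a pG; rewrite le_eqVlt => /predU1P[<-//|apos].
  by move: H; rewrite expr2 ler_pM2r.
(* The maximum of u <t, a> - c Q(t) is at (u / 2c) a, the centre of the new Gaussian. *)
have [s0 s0E] := rowv_surj (- (u / (2 * c)) *: a).
have E t : expR (u * (rowv t *m b^T) 0 0) * gaussian c t =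
    expR (u ^+ 2 * bilin G a a / (4 * c)) * gaussian c (affine_tuple 1 s0 t).
  rewrite -(rieszE b _ pG) -/a /gaussian -!expRD /Q rowv_affine s0E scale1r.
  congr expR; rewrite !(bilinDl, bilinDr, bilinZl, bilinZr) (bilinC a _ sG).
  by field; rewrite gt_eqF.
have mg : measurable_fun setT (fun t : T => (gaussian c t)%:E).
  exact: (measurableT_comp (@EFin_measurable R setT) (measurable_gaussian c)).
have g0 (t : T) : (0 <= (gaussian c t)%:E)%E by rewrite lee_fin expR_ge0.
under eq_iint do rewrite E EFinM.
rewrite (iintZl (f := fun t : T => (gaussian c (affine_tuple 1 s0 t))%:E))//; last first.
- by apply: (measurableT_comp mg); exact: measurable_affine_tuple.
rewrite (@iint_affine R D 1 s0 (fun t : T => (gaussian c t)%:E))// expr1n invr1 mul1e.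
apply: lee_wpmul2r; first exact: iint_ge0.
by rewrite lee_fin ler_expR ler_pM2r ?invr_gt0 ?mulr_gt0// ler_wpM2l ?sqr_ge0.
Qed.

(** Comes from z <= e^(z - 1) taken at |y| / 2k and raised to the power 2k. *)
Lemma expr_le_cosh (k : nat) (y : R) : (0 < k)%N ->
  y ^+ (2 * k) <= ((2 * k)%:R / expR 1) ^+ (2 * k) * (expR y + expR (- y)).
Proof.
move=> k0.
have kp : 0 < (2 * k)%:R :> R by rewrite ltr0n muln_gt0.
have H (z : R) : 0 <= z -> z ^+ (2 * k) <= ((2 * k)%:R / expR 1) ^+ (2 * k) * expR z.
  move=> z0.
  have h1 : z / (2 * k)%:R <= expR (z / (2 * k)%:R - 1).
    by have := expR_ge1Dx (z / (2 * k)%:R - 1); lra.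
  have h2 : z <= (2 * k)%:R / expR 1 * expR (z / (2 * k)%:R).
    have -> : (2 * k)%:R / expR 1 * expR (z / (2 * k)%:R) = (2 * k)%:R * expR (z / (2 * k)%:R - 1).
      by rewrite expRD expRN; ring.
    by move: h1; rewrite ler_pdivrMr// mulrC.
  have := lerXn2r (2 * k) (_ : z \in Num.nneg) (_ : _ \in Num.nneg) h2.
  rewrite !nnegrE => /(_ z0) h3.
  apply: le_trans (h3 _) _.
    by rewrite mulr_ge0 ?expR_ge0// divr_ge0 ?expR_ge0 ?ler0n.
  rewrite exprMn -expRM_natr -[_ *+ (2 * k)]mulr_natr divfK//.
  by rewrite mul1r gt_eqF.
have C0 : 0 <= ((2 * k)%:R / expR 1) ^+ (2 * k) :> R.
  by rewrite exprn_ge0// divr_ge0 ?expR_ge0 ?ler0n.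
rewrite mulrDr.
have [y0|y0] := lerP 0 y.
  by apply: le_trans (H _ y0) _; rewrite lerDl mulr_ge0 ?expR_ge0.
rewrite -[y in leLHS]opprK -[- - y]mulN1r exprMn exprM sqrrN !expr1n mul1r.
apply: le_trans (H (- y) _) _; first by rewrite oppr_ge0 ltW.
by rewrite lerDr mulr_ge0 ?expR_ge0.
Qed.

Lemma measurable_rowform (b : 'rV[R]_D) :
  measurable_fun setT (fun t : T => (rowv t *m b^T) 0 0).
Proof.
rewrite (_ : (fun _ => _) = fun t : T => \sum_i tnth t i * b 0 i); last first.
  by apply/funext => t; rewrite !mxE; apply: eq_bigr => i _; rewrite !mxE.
apply: measurable_sum => i.
apply: (@measurable_funM _ T R setT); last exact: measurable_cst.
exact: measurable_tnth.
Qed.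

(** The moment is controlled by the moment generating function at u and -u;
    the choice u^2 = 4ck/M optimizes the resulting bound. *)
Lemma gaussian_moment c (b : 'rV[R]_D) (M : R) (k : nat) : 0 < c -> 0 < M -> (0 < k)%N ->
  (forall v, ((v *m b^T) 0 0) ^+ 2 <= M * bilin G v v) ->
  (iint (fun t : T => (((rowv t *m b^T) 0%R 0%R) ^+ (2 * k) * gaussian c t)%:E)
   <= (2 * (k%:R * M / (c * expR 1)) ^+ k)%:E * iint (fun t : T => (gaussian c t)%:E))%E.
Proof.
move=> c0 M0 k0 bM.
have kp : 0 < k%:R :> R by rewrite ltr0n.
pose u := Num.sqrt (4 * c * k%:R / M).
have u2 : u ^+ 2 = 4 * c * k%:R / M by rewrite sqr_sqrtr// ltW// divr_gt0// !mulr_gt0.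
have u0 : 0 < u by rewrite sqrtr_gt0 divr_gt0// !mulr_gt0.
pose K := ((2 * k)%:R / expR 1 / u) ^+ (2 * k).
have K0 : 0 <= K by rewrite exprn_ge0// !divr_ge0 ?expR_ge0 ?ler0n// ltW.
pose E (s : R) (t : T) := (expR (s * (rowv t *m b^T) 0 0) * gaussian c t)%:E.
have mE s : measurable_fun setT (E s).
  apply: (measurableT_comp (@EFin_measurable R setT)).
  apply: (@measurable_funM _ T R setT); last exact: measurable_gaussian.
  apply: (measurableT_comp (@measurable_expR R)).
  apply: (@measurable_funM _ T R setT); first exact: measurable_cst.
  exact: measurable_rowform.
have E0 s t : (0 <= E s t)%E by rewrite lee_fin mulr_ge0// expR_ge0.
set Z := iint (fun t : T => (gaussian c t)%:E).
have Z0 : (0 <= Z)%E by apply: iint_ge0 => t; rewrite lee_fin expR_ge0.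
apply: (@le_trans _ _ (iint (fun t => K%:E * (E u t + E (- u)%R t))%E)).
  apply: le_iint => t.
    by rewrite lee_fin mulr_ge0 ?expR_ge0// exprM exprn_ge0// sqr_ge0.
  rewrite /E -EFinD -EFinM lee_fin -mulrDl mulrA ler_wpM2r ?expR_ge0//.
  rewrite -[leLHS](mulfK (_ : u ^+ (2 * k) != 0)) ?gt_eqF ?exprn_gt0//.
  rewrite -exprMn ler_pdivrMr ?exprn_gt0// /K expr_div_n -!mulrA (mulrC _ (u ^+ _)).
  rewrite 2!mulrA mulrVK ?unitfE ?gt_eqF ?exprn_gt0//.
  by rewrite (mulrC _ u) mulNr; exact: expr_le_cosh.
rewrite (iintZl (f := fun t => (E u t + E (- u)%R t)%E))//; last first.
- by move=> t; apply: adde_ge0.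
- exact: emeasurable_funD.
rewrite iintD//.
have B s : s ^+ 2 = u ^+ 2 -> (iint (E s) <= (expR k%:R)%:E * Z)%E.
  move=> s2; apply: le_trans (gaussian_mgf s c0 (ltW M0) bM) _.
  apply: lee_wpmul2r => //; rewrite lee_fin ler_expR s2 u2.
  by rewrite le_eqVlt; apply/orP; left; apply/eqP; field; rewrite !gt_eqF.
apply: (@le_trans _ _ (K%:E * ((expR k%:R)%:E * Z + (expR k%:R)%:E * Z)))%E.
  by apply: lee_wpmul2l => //; apply: leeD; apply: B => //; rewrite sqrrN.
rewrite -ge0_muleDl ?lee_fin ?expR_ge0// -EFinD muleA -EFinM.
apply: lee_wpmul2r => //; rewrite lee_fin -mulr2n.
rewrite -(mulr_natl (expR _)) mulrCA ler_wpM2l// /K exprM.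
have -> : expR (k%:R : R) = expR 1 ^+ k by rewrite -expRM_natr mul1r.
rewrite -exprMn.
rewrite le_eqVlt; apply/orP; left; apply/eqP; congr (_ ^+ _).
rewrite !expr_div_n u2 natrM; field; rewrite !gt_eqF ?expR_gt0//.
Qed.

End Gaussian.

(** * Volume of sets containing a sublevel set of a power integral *)

Section Volume.
Context {R : realType} {D : nat}.
Local Notation Rm := (measurableTypeR R).
Local Notation leb := (@lebesgue_measure R).
Local Notation T := (D.-tuple Rm).

Lemma le_lebesgue_tuple (A B : set (D.-tuple R)) : A `<=` B ->
  (lebesgue_tuple A <= lebesgue_tuple B)%E.
Proof.
move=> AB; rewrite !lebesgue_tuple_iint; apply: le_iint => t; rewrite !indicE lee_fin//.
rewrite ler_nat; have [At|At] := pselect (A t); last by rewrite (memNset At).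
by rewrite !mem_set//; exact: AB.
Qed.

Lemma lebesgue_tuple_ge0 (A : set (D.-tuple R)) : (0 <= lebesgue_tuple A)%E.
Proof. by rewrite lebesgue_tuple_iint; apply: iint_ge0 => t; rewrite lee_fin. Qed.

Lemma lebesgue_tuple_box (r : R) : 0 <= r ->
  lebesgue_tuple [set t : D.-tuple R | forall i, `|tnth t i| <= r] = ((2 * r) ^+ D)%:E.
Proof.
move=> r0; rewrite lebesgue_tuple_iint.
pose f (x : Rm) : R := \1_(`[(- r : R), r]%classic) x.
have mf : measurable_fun setT f.
  by apply: (@measurable_indic _ Rm R setT); exact: measurable_itv.
rewrite (eq_iint (g := fun t : T => (\prod_(i < D) f (tnth t i))%:E)); last first.
  move=> t; congr (_%:E); rewrite indicE.
  have [H|H] := pselect (forall i, `|tnth t i| <= r).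
    rewrite mem_set// big1// => i _.
    by rewrite /f indicE mem_set//= in_itv/= -ler_norml.
  rewrite memNset//; have /existsNP[i Hi] := H.
  rewrite (bigD1 i)//= /f indicE memNset ?mul0r//= in_itv/= -ler_norml.
  exact: Hi.
rewrite iint_prod//.
rewrite integral_indic//= setIT lebesgue_measure_itv/= lte_fin.
case: ifP => [_|/negbT]; first by rewrite -EFinB -EFin_expe; congr ((_ ^+ _)%:E); lra.
rewrite -leNgt => rr; have -> : r = 0 by lra.
by rewrite mulr0 EFin_expe.
Qed.

Variables (G : 'M[R]_D) (pG : posdef G).
Let Q (t : D.-tuple R) := bilin G (rowv t) (rowv t).

Lemma ellipsoid_bounded (C : R) : exists2 r : R, 0 <= r &
  forall t, Q t <= C -> forall i, `|tnth t i| <= r.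
Proof.
have [e e0 He] := posdef_lower pG.
have C0 : 0 <= `|C| / e by rewrite divr_ge0// ltW.
exists (Num.sqrt (`|C| / e)); first exact: sqrtr_ge0.
move=> t tC i; rewrite -sqrtr_sqr ler_wsqrtr// ler_pdivlMr// mulrC.
apply: le_trans (ler_norm C); apply: le_trans tC; apply: le_trans (He _).
rewrite ler_wpM2l ?(ltW e0)// (bigD1 i)//= mxE lerDl.
by apply: sumr_ge0 => j _; exact: sqr_ge0.
Qed.

Lemma ellipsoid_pinfty : (lebesgue_tuple [set t | (Q t <= 1)%R] < +oo)%E.
Proof.
have [r r0 Hr] := ellipsoid_bounded 1.
apply: le_lt_trans (le_lebesgue_tuple (_ : _ `<=` [set t | forall i, `|tnth t i| <= r])) _.
  by move=> t /= /Hr.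
by rewrite lebesgue_tuple_box// ltry.
Qed.

Lemma ellipsoid_gt0 : (0 < lebesgue_tuple [set t | (Q t <= 1)%R])%E.
Proof.
have [C C0 HC] := bilin_upper G.
pose r := Num.sqrt ((C * (D%:R + 1))^-1).
have h : 0 < C * (D%:R + 1) by rewrite mulr_gt0// ltr_wpDl.
have r0 : 0 < r by rewrite sqrtr_gt0 invr_gt0.
apply: (@lt_le_trans _ _ ((2 * r) ^+ D)%:E).
  by rewrite lte_fin exprn_gt0// mulr_gt0.
rewrite -(lebesgue_tuple_box (ltW r0)); apply: le_lebesgue_tuple => t /= tr.
apply: le_trans (HC _) _; rewrite mulrC -ler_pdivlMr// mul1r.
apply: (@le_trans _ _ (\sum_(i < D) r ^+ 2)).
  apply: ler_sum => i _; rewrite mxE -real_normK ?num_real//.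
  by rewrite lerXn2r ?nnegrE// ltW.
rewrite sumr_const card_ord /r sqr_sqrtr ?invr_ge0 ?(ltW h)//.
rewrite -[leLHS]mulr_natr invfM -mulrA ler_piMr ?invr_ge0 ?(ltW C0)//.
by rewrite mulrC ler_pdivrMr ?ltr_wpDl// mul1r lerDl.
Qed.

Lemma measurable_sublevel (f : T -> \bar R) (l : \bar R) :
  measurable_fun setT f -> measurable [set t : T | (f t <= l)%E].
Proof.
by move=> mf; rewrite -[X in measurable X]setTI; apply: emeasurable_fun_infty_c.
Qed.

Variables (d : measure_display) (S : measurableType d)
  (mu : {sigma_finite_measure set S -> \bar R}).
Variables (b : S -> 'rV[R]_D) (M c : R) (k : nat).
Hypotheses (mb : forall i, measurable_fun setT (fun z => b z 0 i))
  (muT : (mu setT <= 1)%E) (c0 : 0 < c) (M0 : 0 < M) (k0 : (0 < k)%N).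
Hypothesis bM : forall z v, ((v *m (b z)^T) 0 0) ^+ 2 <= M * bilin G v v.

Let l z (t : D.-tuple R) : R := (rowv t *m (b z)^T) 0 0.

Definition power_integral (t : D.-tuple R) : \bar R :=
  (\int[mu]_z ((l z t) ^+ (2 * k))%:E)%E.

Lemma measurable_pairing :
  measurable_fun setT (fun w : S * T => l w.1 w.2 ^+ (2 * k)).
Proof.
apply: (@measurable_funX _ (S * T)%type R).
rewrite (_ : (fun _ => _) = fun w : S * T => \sum_i tnth w.2 i * b w.1 0 i); last first.
  by apply/funext => w; rewrite /l !mxE; apply: eq_bigr => i _; rewrite !mxE.
apply: measurable_sum => i.
apply: (@measurable_funM _ (S * T)%type R setT).
  apply: (measurableT_comp (@measurable_tnth _ Rm D i)); exact: measurable_snd.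
by apply: (measurableT_comp (mb i)); exact: measurable_fst.
Qed.

Lemma measurable_power_integral : measurable_fun setT (power_integral : T -> _).
Proof.
apply: (@measurable_fun_fubini_tonelli_G _ _ S T R mu
  (fun w : S * T => (l w.1 w.2 ^+ (2 * k))%:E)).
  exact: (measurableT_comp (@EFin_measurable R setT) measurable_pairing).
by move=> w; rewrite lee_fin exprM exprn_ge0 ?sqr_ge0.
Qed.

Lemma power_integral_ge0 t : (0 <= power_integral t)%E.
Proof. by apply: integral_ge0 => z _; rewrite lee_fin exprM exprn_ge0 ?sqr_ge0. Qed.

(** Twice the bound on the Gaussian mean of the power integral: the threshold
    in Markov's inequality. *)
Let lam : R := 2 * (2 * (k%:R * M / (c * expR 1)) ^+ k).
Let Z := iint (fun t : T => (gaussian G c t)%:E).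

Let lam0 : 0 < lam.
Proof.
by rewrite !mulr_gt0// exprn_gt0// divr_gt0 ?mulr_gt0 ?ltr0n ?expR_gt0.
Qed.

Let Z0 : (0 <= Z)%E.
Proof. by apply: iint_ge0 => t; rewrite lee_fin expR_ge0. Qed.

(** Tonelli exchanges the Gaussian integral with the one over the parameter,
    reducing to the moments of one linear form at a time. *)
Lemma gaussian_power_integral :
  (iint (fun t : T => power_integral t * (gaussian G c t)%:E) <= (lam / 2)%:E * Z)%E.
Proof.
rewrite (eq_iint (g := fun t : T => (\int[mu]_z ((l z t) ^+ (2 * k) * gaussian G c t)%:E)%E)); last first.
  move=> t; rewrite /power_integral -ge0_integralZr//.
  - apply: (measurableT_comp (@EFin_measurable R setT)).
    have h : measurable_fun setT (fun z : S => (z, t) : (S * T)%type).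
      exact: measurable_fun_pair.
    exact: (measurableT_comp measurable_pairing h).
  - by move=> z _; rewrite lee_fin exprM exprn_ge0 ?sqr_ge0.
  - by rewrite lee_fin expR_ge0.
rewrite (iint_tonelli mu (g := fun w : S * T => (l w.1 w.2 ^+ (2 * k) * gaussian G c w.2)%:E)); first last.
- by move=> w; rewrite lee_fin mulr_ge0 ?expR_ge0// exprM exprn_ge0 ?sqr_ge0.
- apply: (measurableT_comp (@EFin_measurable R setT)).
  apply: (@measurable_funM _ (S * T)%type R setT); first exact: measurable_pairing.
  apply: (measurableT_comp (measurable_gaussian G c)); exact: measurable_snd.
have lZ0 : (0 <= (lam / 2)%:E * Z)%E by rewrite mule_ge0// lee_fin divr_ge0// ltW.
apply: (@le_trans _ _ (\int[mu]_z (cst ((lam / 2)%:E * Z) z))%E).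
  apply: le_ge0_integral => z.
    by apply: iint_ge0 => t; rewrite lee_fin mulr_ge0 ?expR_ge0// exprM exprn_ge0 ?sqr_ge0.
  apply: le_trans (gaussian_moment pG c0 M0 k0 (bM z)) _.
  suff -> : lam / 2 = 2 * (k%:R * M / (c * expR 1)) ^+ k by [].
  by rewrite /lam mulrC mulKf // pnatr_eq0.
rewrite integral_cst//; apply: le_trans (lee_wpmul2l lZ0 muT) _.
by rewrite mule1.
Qed.

(** Markov: at most half of the Gaussian mass lies where the power integral
    exceeds twice the bound on its Gaussian mean, so the sublevel set has
    volume at least half of the mass. The mass itself is at least e^(-c)
    times the volume of the ellipsoid, on which the weight is at least
    e^(-c). *)
Lemma power_sublevel_volume :
  ((expR (- c) / 2)%:E * lebesgue_tuple [set t | (Q t <= 1)%R] <=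
   lebesgue_tuple [set t | power_integral t <= lam%:E])%E.
Proof.
set A := [set t : D.-tuple R | (power_integral t <= lam%:E)%E].
have mA : measurable (A : set T) by exact: measurable_sublevel measurable_power_integral.
have mg : measurable_fun setT (fun t : T => (gaussian G c t)%:E).
  exact: (measurableT_comp (@EFin_measurable R setT) (measurable_gaussian G c)).
have g0 (t : T) : (0 <= (gaussian G c t)%:E)%E by rewrite lee_fin expR_ge0.
have mpg : measurable_fun setT (fun t : T => power_integral t * (gaussian G c t)%:E)%E.
  by apply: emeasurable_funM => //; exact: measurable_power_integral.
have pg0 t : (0 <= power_integral t * (gaussian G c t)%:E)%E.
  by rewrite mule_ge0// power_integral_ge0.
have m1 : measurable_fun setT (fun t : T => (\1_A t)%:E : \bar R).
  by apply: (measurableT_comp (@EFin_measurable R setT)); exact: measurable_indic.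
have li0 : 0 <= lam^-1 by rewrite invr_ge0 ltW.
have step1 : (Z <= lebesgue_tuple A + (2^-1)%:E * Z)%E.
  apply: (@le_trans _ _ (iint (fun t : T => (\1_A t)%:E +
      (lam^-1)%:E * (power_integral t * (gaussian G c t)%:E))%E)).
    apply: le_iint => // t; rewrite indicE.
    have [tA|tA] := pselect (A t).
      rewrite mem_set//=; apply: le_trans (leeDl _ _); last by rewrite mule_ge0.
      rewrite lee_fin /gaussian -expR0 ler_expR oppr_le0 mulr_ge0 ?(ltW c0)//.
      exact: posdef_ge0.
    rewrite memNset// add0e muleA -[leLHS]mul1e.
    apply: lee_wpmul2r => //; move: tA; rewrite /A /= => /negP; rewrite -ltNge => tA.
    rewrite -[leLHS](_ : ((lam^-1)%:E * lam%:E)%E = _).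
      by apply: lee_wpmul2l => //; exact: ltW.
    by rewrite -EFinM mulVf ?gt_eqF.
  rewrite iintD//; last 2 first.
  - by apply: measurable_funeM.
  - by move=> t; rewrite mule_ge0.
  rewrite -lebesgue_tuple_iint leeD2l// iintZl//.
  apply: (@le_trans _ _ ((lam^-1)%:E * ((lam / 2)%:E * Z))%E).
    by apply: lee_wpmul2l => //; exact: gaussian_power_integral.
  by rewrite muleA -EFinM mulrA mulVf ?mul1r// gt_eqF.
have step2 : ((expR (- c))%:E * lebesgue_tuple [set t | (Q t <= 1)%R] <= Z)%E.
  rewrite lebesgue_tuple_iint -iintZl ?expR_ge0//.
    apply: le_iint => t; first by rewrite -EFinM lee_fin mulr_ge0 ?expR_ge0.
    rewrite -EFinM lee_fin indicE.
    have [tA|tA] := pselect (Q t <= 1); last first.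
      by rewrite memNset// (_ : false%:R = 0 :> R)// mulr0 expR_ge0.
    rewrite mem_set// (_ : true%:R = 1 :> R)// mulr1 ler_expR lerN2 -[leRHS]mulr1.
    by rewrite ler_wpM2l ?(ltW c0).
  apply: (measurableT_comp (@EFin_measurable R setT)); apply: measurable_indic.
  rewrite [X in measurable X](_ : _ = [set t : T | ((Q t)%:E <= 1%:E)%E]).
    apply: measurable_sublevel.
    exact: (measurableT_comp (@EFin_measurable R setT) (measurable_bilin G)).
  by apply/seteqP; split => t /=; rewrite lee_fin.
have Zfin : Z \is a fin_num by rewrite ge0_fin_numE//; exact: gaussian_fin.
have step3 : ((2^-1)%:E * Z <= lebesgue_tuple A)%E.
  move: step1; rewrite -(fineK Zfin); have := lebesgue_tuple_ge0 A.
  case: (lebesgue_tuple A) => [v _| |//]; last by move=> _ _; exact: leey.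
  by rewrite -!EFinM -EFinD !lee_fin; lra.
apply: le_trans step3; rewrite mulrC EFinM -muleA.
by apply: lee_wpmul2l => //; rewrite lee_fin.
Qed.

(** K contains the image W of the sublevel set under an affine map, whose
    volume is given by the change of variables. *)
Lemma volume_lower_bound (K : set (D.-tuple R)) (s : R) (t0 : D.-tuple R) : 0 < s ->
  (forall t, (power_integral t <= lam%:E)%E -> K (affine_tuple s t0 t)) ->
  ((s ^+ D * (expR (- c) / 2))%:E * lebesgue_tuple [set t | (Q t <= 1)%R] <=
   lebesgue_tuple K)%E.
Proof.
move=> s0 HK.
have sD : 0 < s ^+ D by rewrite exprn_gt0.
pose t1 : D.-tuple R := [tuple - s^-1 * tnth t0 i | i < D].
have inv1 t : affine_tuple s^-1 t1 (affine_tuple s t0 t) = t.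
  apply: eq_from_tnth => i; rewrite !tnth_mktuple; field; exact: lt0r_neq0.
have inv2 t : affine_tuple s t0 (affine_tuple s^-1 t1 t) = t.
  apply: eq_from_tnth => i; rewrite !tnth_mktuple; field; exact: lt0r_neq0.
pose A := [set t : D.-tuple R | (power_integral t <= lam%:E)%E].
pose W := [set t : D.-tuple R | A (affine_tuple s^-1 t1 t)].
have mW : measurable (W : set T).
  apply: (measurable_sublevel (f := power_integral \o affine_tuple s^-1 t1)).
  apply: (measurableT_comp measurable_power_integral); exact: measurable_affine_tuple.
have m1 : measurable_fun setT (fun t : T => (\1_W t)%:E : \bar R).
  by apply: (measurableT_comp (@EFin_measurable R setT)); exact: measurable_indic.
apply: (@le_trans _ _ (lebesgue_tuple W)); last first.
  by apply: le_lebesgue_tuple => t /= /HK; rewrite inv2.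
have -> : lebesgue_tuple W = ((s ^+ D)%:E * lebesgue_tuple A)%E.
  rewrite [in RHS]lebesgue_tuple_iint.
  rewrite (eq_iint (g := fun t : T => (\1_W (affine_tuple s t0 t))%:E)); last first.
    move=> t; rewrite !indicE; congr ((nat_of_bool _)%:R%:E).
    by apply/idP/idP => /set_mem /= H; apply/mem_set; move: H; rewrite /W /= inv1.
  rewrite (@iint_affine R D s t0 (fun t : T => (\1_W t)%:E))//.
    by rewrite muleA -EFinM divff ?mul1e ?lt0r_neq0// lebesgue_tuple_iint.
rewrite EFinM -muleA; apply: lee_wpmul2l; first by rewrite lee_fin ltW.
exact: power_sublevel_volume.
Qed.

End Volume.

(** * Sup norm against L2 norm on a homogeneous space *)

Section SupBound.
Context {R : realType} {d : measure_display} {T : measurableType d}.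
Variables (mu : {measure set T -> \bar R}) (X : set T) (N : nat) (b : 'I_N -> T -> R).
Hypotheses (mX : measurable X) (muX : mu X = 1%E).

Definition comb (c : 'rV[R]_N) (x : T) : R := \sum_i c 0 i * b i x.

Definition gram : 'M[R]_N := \matrix_(i, j) \int[mu]_(x in X) (b i x * b j x).

Hypothesis ib : forall i j, mu.-integrable X (EFin \o (fun x => b i x * b j x)).

Lemma Rintegral_sum (I : Type) (s : seq I) (f : I -> T -> R) :
  (forall i, mu.-integrable X (EFin \o f i)) ->
  mu.-integrable X (EFin \o (fun x => \sum_(i <- s) f i x)) /\
  \int[mu]_(x in X) (\sum_(i <- s) f i x) = \sum_(i <- s) \int[mu]_(x in X) f i x.
Proof.
move=> fi; elim: s => [|i s [IH1 IH2]].
  rewrite big_nil; under eq_Rintegral do rewrite big_nil.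
  rewrite Rintegral_cst// mul0r; split => //.
  by rewrite (_ : _ \o _ = cst 0%E); [exact: integrable0 | apply/funext => x /=; rewrite big_nil].
split.
  rewrite (_ : _ \o _ = ((EFin \o f i) \+ (EFin \o (fun x => (\sum_(i <- s) f i x)%R)))%E).
    exact: integrableD.
  by apply/funext => x /=; rewrite big_cons.
rewrite big_cons -IH2 -RintegralD//.
by apply: eq_Rintegral => x _; rewrite big_cons.
Qed.

Lemma integrable_mulrl (a : R) (f : T -> R) : mu.-integrable X (EFin \o f) ->
  mu.-integrable X (EFin \o (fun x => a * f x)).
Proof.
move=> fi; rewrite (_ : _ \o _ = fun x => (a%:E * (EFin \o f) x)%E).
  exact: integrableZl.
by apply/funext => x.
Qed.

Lemma combM c c' x :
  comb c x * comb c' x = \sum_i \sum_j c 0 i * c' 0 j * (b i x * b j x).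
Proof.
rewrite /comb mulr_suml; apply: eq_bigr => i _; rewrite mulr_sumr.
by apply: eq_bigr => j _; ring.
Qed.

Lemma integrable_combM c c' : mu.-integrable X (EFin \o (fun x => comb c x * comb c' x)).
Proof.
under [X in _.-integrable _ (_ \o X)]eq_fun do rewrite combM.
apply: (Rintegral_sum _ _).1 => i; apply: (Rintegral_sum _ _).1 => j.
exact: integrable_mulrl.
Qed.

Lemma Rintegral_combM c c' : \int[mu]_(x in X) (comb c x * comb c' x) = bilin gram c c'.
Proof.
under eq_Rintegral do rewrite combM.
have h i j : mu.-integrable X (EFin \o (fun x => c 0 i * c' 0 j * (b i x * b j x))).
  exact: integrable_mulrl.
rewrite (Rintegral_sum _ _).2; last by move=> i; apply: (Rintegral_sum _ _).1.
rewrite bilinE; apply: eq_bigr => i _.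
rewrite (Rintegral_sum _ _).2//; apply: eq_bigr => j _.
by rewrite RintegralZl// mxE; ring.
Qed.

Lemma gram_sym : gram^T = gram.
Proof. by apply/matrixP => i j; rewrite !mxE; apply: eq_Rintegral => x _; rewrite mulrC. Qed.

Lemma gram_ge0 c : 0 <= bilin gram c c.
Proof. by rewrite -Rintegral_combM; apply: Rintegral_ge0 => x _; rewrite -expr2 sqr_ge0. Qed.

Hypothesis free_b : forall c, (forall x, X x -> comb c x = 0) -> c = 0.

Hypothesis inv_b : forall u v, X u -> X v -> exists phi : T -> T, phi u = v /\
  forall c, exists c', (forall x, comb c' x = comb c (phi x)) /\
     bilin gram c' c' = bilin gram c c.

Lemma gram_null c : bilin gram c c = 0 -> c *m gram = 0.
Proof.
move=> c0; apply/rowP => j.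
have := bilin_cauchy_schwarz c (delta_mx 0 j) gram_sym gram_ge0.
rewrite c0 mul0r => h.
have : bilin gram c (delta_mx 0 j) = 0 by apply/eqP; rewrite -sqrf_eq0 eq_le h sqr_ge0.
by rewrite /bilin trmx_delta -colE !mxE.
Qed.

(** The squares of a spanning family of null combinations have a sum of
    integral zero, which therefore vanishes at some point z of X: all null
    combinations vanish at z. Since null combinations are permuted by the
    maps phi, which move z anywhere, they vanish on all of X, and freeness
    concludes. *)
Lemma gram_posdef : posdef gram.
Proof.
split; first exact: gram_sym.
move=> c cn0; rewrite lt_neqAle gram_ge0 andbT eq_sym; apply/negP => /eqP c0.
pose h x := \sum_j comb (row j (kermx gram)) x * comb (row j (kermx gram)) x.
have hint : \int[mu]_(x in X) h x = 0.
  rewrite (Rintegral_sum _ _).2; last by move=> i; exact: integrable_combM.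
  rewrite big1// => i _; rewrite Rintegral_combM /bilin.
  have /sub_kermxP -> : (row i (kermx gram) <= kermx gram)%MS by exact: row_sub.
  by rewrite mul0mx mxE.
have ih : mu.-integrable X (EFin \o h).
  by apply: (Rintegral_sum _ _).1 => j; exact: integrable_combM.
have h0 x : 0 <= h x by apply: sumr_ge0 => j _; rewrite -expr2 sqr_ge0.
have [z Xz hz] : exists2 z, X z & h z = 0.
  apply: contrapT => nz.
  have hX : (\int[mu]_(x in X) `|(EFin \o h) x| = 0)%E.
    have fin : (\int[mu]_(x in X) (EFin \o h) x)%E \is a fin_num by exact: integrable_fin_num.
    rewrite (eq_integral (EFin \o h)); last by move=> x _; rewrite /= ger0_norm.
    by rewrite -(fineK fin); congr (_%:E); exact: hint.
  have mh : measurable_fun X (EFin \o h) by case/integrableP: ih.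
  have /(ae_eq_integral_abs mu mX mh) [A [mA A0 AH]] := hX.
  have : (mu X <= mu A)%E.
    apply: le_measure; rewrite ?inE// => x Xx; apply: AH => /= /(_ Xx) [hx].
    by apply: nz; exists x.
  by rewrite muX A0 lee_fin ler10.
have hzj j : comb (row j (kermx gram)) z = 0.
  apply/eqP; rewrite -sqrf_eq0 expr2; apply/eqP.
  have := hz; rewrite /h => /eqP; rewrite psumr_eq0; last by move=> i _; rewrite -expr2 sqr_ge0.
  by move=> /allP /(_ j (mem_index_enum _)) /implyP /(_ isT) /eqP.
move: cn0 => /eqP; apply; apply: free_b => u Xu.
have [phi [phiz H]] := inv_b Xz Xu.
have [c' [c'E c'c]] := H c.
rewrite -phiz -c'E.
have /sub_kermxP/submxP[w wE] : c' *m gram = 0 by apply: gram_null; rewrite c'c.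
rewrite /comb wE.
transitivity (\sum_j w 0 j * comb (row j (kermx gram)) z).
  rewrite /comb; under [RHS]eq_bigr do rewrite mulr_sumr.
  rewrite exchange_big /=; apply: eq_bigr => i _; rewrite mxE mulr_suml.
  by apply: eq_bigr => j _; rewrite [in RHS]mxE mulrA.
by rewrite big1// => j _; rewrite hzj mulr0.
Qed.

Let ev x : 'rV[R]_N := \row_i b i x.
(** The reproducing kernel of the span of b; K is its value on the diagonal,
    that is the squared norm of evaluation at a point. *)
Let kerv x := riesz gram (ev x).
Let K x := bilin gram (kerv x) (kerv x).

Let comb_ev c x : comb c x = (c *m (ev x)^T) 0 0.
Proof. by rewrite mxE; apply: eq_bigr => i _; rewrite !mxE. Qed.

Let comb_le c x : comb c x ^+ 2 <= K x * bilin gram c c.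
Proof.
rewrite comb_ev -(rieszE _ _ gram_posdef).
by rewrite mulrC; apply: bilin_cauchy_schwarz gram_sym gram_ge0.
Qed.

(** Evaluation at v is the composite of evaluation at u with an isometry of
    the span, so its norm is not larger. *)
Let K_le u v : X u -> X v -> K v <= K u.
Proof.
move=> Xu Xv; have [phi [<- H]] := inv_b Xu Xv.
have [c' [c'E c'c]] := H (kerv (phi u)).
have := comb_le c' u; rewrite c'E c'c comb_ev -(rieszE _ _ gram_posdef).
rewrite -/(kerv _) -/(K (phi u)) expr2 => h.
have := gram_ge0 (kerv (phi u)); rewrite -/(K _) le_eqVlt => /predU1P[<-|K0].
  exact: gram_ge0.
by move: h; rewrite ler_pM2r.
Qed.

Let K_sum x : K x = \sum_i \sum_j invmx gram i j * (b i x * b j x).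
Proof.
rewrite /K rieszE; last exact: gram_posdef.
rewrite /kerv /riesz mxE exchange_big /=; apply: eq_bigr => j _.
rewrite !mxE mulr_suml; apply: eq_bigr => i _; rewrite !mxE; ring.
Qed.

Let K_int : \int[mu]_(x in X) K x = N%:R.
Proof.
under eq_Rintegral do rewrite K_sum.
have h i j : mu.-integrable X (EFin \o (fun x => invmx gram i j * (b i x * b j x))).
  exact: integrable_mulrl.
rewrite (Rintegral_sum _ _).2; last by move=> i; apply: (Rintegral_sum _ _).1.
transitivity (\tr (invmx gram *m gram)).
  apply: eq_bigr => i _; rewrite (Rintegral_sum _ _).2// mxE; apply: eq_bigr => j _.
  by rewrite RintegralZl// -gram_sym !mxE.
by rewrite mulVmx ?mxtrace1//; exact: posdef_unit gram_posdef.
Qed.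

(** The diagonal K of the reproducing kernel is constant by homogeneity, and
    its integral is the trace of the identity, the dimension N. Hence
    evaluation at any point has squared norm N. *)
Theorem homogeneous_sup_bound c x : X x ->
  comb c x ^+ 2 <= N%:R * \int[mu]_(y in X) (comb c y ^+ 2).
Proof.
move=> Xx.
have <- : K x = N%:R.
  rewrite -K_int.
  have -> : \int[mu]_(y in X) K y = \int[mu]_(y in X) K x.
    by apply: eq_Rintegral => y /set_mem Xy; apply/eqP; rewrite eq_le !K_le.
  by rewrite Rintegral_cst// muX mulr1.
rewrite (_ : \int[mu]_(y in X) _ = bilin gram c c); first exact: comb_le.
by rewrite -Rintegral_combM; apply: eq_Rintegral => y _; rewrite expr2.
Qed.

End SupBound.

(** * Homogeneous polynomials as functions *)

Section Polynomials.
Context {R : realType} {n : nat}.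
Implicit Types (p q : mpoly n R) (x y v : 'cV[R]_n).

Local Notation homog a := (@ishomog1 n R a (@mdeg n)).

Definition evalp p x : R := meval (fun i => x i 0) p.

Lemma mmap_homog (S : comNzRingType) (f : {rmorphism R -> S}) (h : 'I_n -> S) (s : S) a p :
  p \in homog a -> mmap f (fun i => s * h i) p = s ^+ a * mmap f h p.
Proof.
move=> /dhomogP pa; rewrite /mmap mulr_sumr big_seq [RHS]big_seq.
apply: eq_bigr => m mp; rewrite mulrCA; congr (_ * _).
rewrite /mmap1; under eq_bigr do rewrite exprMn.
rewrite big_split /=; congr (_ * _).
have <- : mdeg m = a by exact: pa.
by rewrite mdegE expr_sum.
Qed.

Lemma eq_mmap (S : nzRingType) (f : R -> S) (h h' : 'I_n -> S) p :
  h =1 h' -> mmap f h p = mmap f h' p.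
Proof. by move=> /funext ->. Qed.

Lemma meval_homogZ a p s x : p \in homog a -> evalp p (s *: x) = s ^+ a * evalp p x.
Proof.
move=> pa; rewrite /evalp /meval -(mmap_homog _ _ _ pa).
by apply: eq_mmap => i; rewrite mxE.
Qed.

(** The univariate polynomial that p induces on the line through x with
    direction y; it turns partial derivatives into ordinary ones. *)
Definition line p x y : {poly R} :=
  mmap (polyC : {rmorphism R -> {poly R}}) (fun i => (x i 0)%:P + (y i 0)%:P * 'X) p.

Lemma horner_line p x y t : (line p x y).[t] = evalp p (x + t *: y).
Proof.
rewrite /line /evalp /meval /mmap -horner_evalE rmorph_sum /=; apply: eq_bigr => m _.
rewrite rmorphM /= horner_evalE hornerC; congr (_ * _).
rewrite /mmap1 rmorph_prod; apply: eq_bigr => i _.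
by rewrite rmorphXn /= horner_evalE !hornerE !mxE mulrC.
Qed.

Lemma lineM p q x y : line (p * q) x y = line p x y * line q x y.
Proof. exact: rmorphM. Qed.

Lemma line1 x y : line 1 x y = 1.
Proof. exact: rmorph1. Qed.

Lemma lineD p q x y : line (p + q) x y = line p x y + line q x y.
Proof. exact: rmorphD. Qed.

Lemma lineZ c p x y : line (c *: p) x y = c%:P * line p x y.
Proof. exact: mmapZ. Qed.

(** Both sides satisfy the Leibniz rule and agree on the variables, hence on
    monomials. *)
Lemma deriv_line p x y : (line p x y)^`() = \sum_i (y i 0)%:P * line (mderiv i p) x y.
Proof.
pose P p := (line p x y)^`() = \sum_i (y i 0)%:P * line (mderiv i p) x y.
have PM q1 q2 : P q1 -> P q2 -> P (q1 * q2).
  rewrite /P => h1 h2; rewrite lineM derivM h1 h2.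
  rewrite mulr_suml mulr_sumr -big_split /=; apply: eq_bigr => i _.
  by rewrite mderivM lineD !lineM; ring.
have P1 : P 1.
  rewrite /P line1 -[1]/(1%:P) derivC big1// => i _.
  by rewrite -mpolyC1 mderivC /line rmorph0 mulr0.
have PX j : P (mpolyX R (mnm1 j)).
  rewrite /P {1}/line mmapX mmap1U derivD derivC add0r derivM derivC mul0r add0r derivX mulr1.
  rewrite (bigD1 j)//= big1 => [|i ij].
    rewrite addr0 mderivX mnm1E eqxx scale1r (_ : mnm_sub _ _ = mnm0).
      by rewrite mpolyX0 line1 mulr1.
    by apply/mnmP => l; rewrite mnmBE subnn mnm0E.
  by rewrite mderivX mnm1E eq_sym (negPf ij) scale0r /line rmorph0 mulr0.
have PXn j k : P (mpolyX R (mnm1 j) ^+ k).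
  by elim: k => [|k IH]; rewrite ?expr0// exprS; exact: PM.
rewrite -/(P p); elim/mpolyind: p => [|c m q _ _ IH].
  rewrite /P /line rmorph0 deriv0 big1// => i _.
  by rewrite linear0 rmorph0 mulr0.
have Pm : P (mpolyX R m) by rewrite mpolyXE_id; apply: big_ind => //.
move: IH Pm; rewrite /P lineD lineZ derivD derivM derivC mul0r add0r => -> ->.
rewrite mulr_sumr -big_split /=; apply: eq_bigr => i _.
by rewrite mderivD mderivZ lineD lineZ; ring.
Qed.

Lemma mderiv_homog a i p : p \in homog a.+1 -> mderiv i p \in homog a.
Proof.
move=> /dhomogP pa; apply/dhomogP => m; rewrite mcoeff_msupp mcoeff_mderiv => h.
have : mnm_add m (mnm1 i) \in msupp p.
  by rewrite mcoeff_msupp; apply: contraNneq h => ->; rewrite mul0rn.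
move=> mi; have : mdeg (mnm_add m (mnm1 i)) = a.+1 by exact: pa.
by rewrite mdegD mdeg1 addn1 => -[].
Qed.

(** Derivative at 1 of the identity p(tx) = t^a p(x) between polynomials in
    t. *)
Lemma euler a p x : p \in homog a ->
  \sum_i x i 0 * evalp (mderiv i p) x = a%:R * evalp p x.
Proof.
move=> pa.
have l0 : line p 0 x = evalp p x *: 'X^a.
  rewrite /line.
  have -> : mmap (polyC : {rmorphism R -> {poly R}})
      (fun i => ((0 : 'cV[R]_n) i 0)%:P + (x i 0)%:P * 'X) p =
    mmap (polyC : {rmorphism R -> {poly R}}) (fun i => 'X * (x i 0)%:P) p.
    by apply: eq_mmap => i; rewrite mxE polyC0 add0r mulrC.
  rewrite (mmap_homog _ _ _ pa) mulrC -mul_polyC; congr (_ * _).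
  rewrite /evalp /meval /mmap rmorph_sum; apply: eq_bigr => m _ /=.
  rewrite rmorphM /=; congr (_ * _); rewrite /mmap1 rmorph_prod.
  by apply: eq_bigr => i _; rewrite rmorphXn.
have := deriv_line p 0 x; rewrite l0 => /(congr1 (fun q : {poly R} => q.[1])).
rewrite derivZ derivXn !hornerE hornerMn hornerXn expr1n horner_sum => h.
transitivity (evalp p x * a%:R); last by rewrite mulrC.
rewrite -[a%:R]/(1 *+ a) h; apply: eq_bigr => i _.
by rewrite hornerM hornerC horner_line add0r scale1r.
Qed.

Lemma horner_inj (q : {poly R}) : (forall t, q.[t] = 0) -> q = 0.
Proof.
move=> q0; apply/eqP/negP => /negP qn0.
pose rs : seq R := [seq i%:R | i <- iota 0 (size q)].
have := @max_poly_roots _ _ rs qn0.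
rewrite size_map size_iota ltnn => h; suff : false by []. apply: h => //.
  apply/allP => z _; rewrite rootE; apply/eqP; exact: q0.
rewrite map_inj_uniq ?iota_uniq//.
by move=> i j /eqP; rewrite eqr_nat => /eqP.
Qed.

(** Induction on the degree: the partial derivatives vanish as functions too,
    hence as polynomials, and a nonzero coefficient in positive degree would
    survive in one of them. *)
Lemma evalp_inj a p : p \in homog a -> (forall x, evalp p x = 0) -> p = 0.
Proof.
elim: a p => [|a IH] p pa p0.
  have pC : p = mpolyC n (mcoeff mnm0 p).
    apply/mpolyP => m; rewrite mcoeffC; have [->|m0] := eqVneq; first by rewrite mulr1.
    rewrite mulr0; apply: (dhomog_nemf_coeff pa).
    by rewrite [_ m]/(mdeg m) mdeg_eq0; move: m0; rewrite eq_sym.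
  by have := p0 0; rewrite {1}pC /evalp mevalC => p00; rewrite pC p00 mpolyC0.
have d0 i : mderiv i p = 0.
  apply: (IH _ (mderiv_homog i pa)) => x.
  have := deriv_line p x (delta_mx i 0).
  have -> : line p x (delta_mx i 0) = 0.
    by apply: horner_inj => t; rewrite horner_line.
  rewrite deriv0 => /(congr1 (fun q : {poly R} => q.[0])).
  rewrite horner0 horner_sum (bigD1 i)//= big1 => [|j ji].
    by rewrite addr0 mxE !eqxx mul1r horner_line scale0r addr0.
  by rewrite mxE (negPf ji) mul0r horner0.
apply/mpolyP => m; rewrite mcoeff0.
have [md|md] := eqVneq (mdeg m) a.+1; last exact: (dhomog_nemf_coeff pa).
have [i mi] : exists i, (0 < m i)%N.
  apply: contrapT => nm; move: md; rewrite mdegE big1// => i _.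
  by apply/eqP; rewrite -leqn0 leqNgt; apply/negP => mi; apply: nm; exists i.
have := mcoeff_mderiv i p (mnm_sub m (mnm1 i)).
rewrite d0 mcoeff0 submK ?lep1mP -?lt0n// => /esym/eqP.
by rewrite mulrn_eq0 => /eqP.
Qed.

Lemma comp_linear_homog a p (Q : 'M[R]_n) : p \in homog a ->
  exists2 q, q \in homog a & forall x, evalp q x = evalp p (Q *m x).
Proof.
move=> pa.
pose L := [tuple \sum_j Q i j *: mpolyX R (mnm1 j) | i < n].
exists (comp_mpoly L p); last first.
  move=> x; rewrite /evalp comp_mpoly_meval; congr (meval _ p); apply/funext => i.
  rewrite tnth_mktuple raddf_sum mxE /=; apply: eq_bigr => j _.
  by rewrite mevalZ mevalXU.
rewrite comp_mpolyE; rewrite big_seq; apply: rpred_sum => m mp; apply: rpredZ.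
have <- : mdeg m = a by move/dhomogP: pa => /(_ _ mp).
rewrite mdegE; apply: (big_ind2 (fun q k => q \in homog k)).
- exact: dhomog1.
- by move=> ? ? ? ? ? ?; exact: dhomogM.
move=> i _; rewrite -[X in _ \in homog X]mul1n; apply: dhomogMn.
rewrite tnth_mktuple; apply: rpred_sum => j _; apply: rpredZ.
by rewrite dhomogX; apply/eqP; exact: mdeg1.
Qed.

End Polynomials.

(** * Hessian forms and convexity *)

Section Hessian.
Context {R : realType} {n d : nat}.
Hypotheses (n0 : (0 < n)%N) (d0 : (0 < d)%N).
Implicit Types (p q : forms R n d) (x y : 'cV[R]_n).
Local Notation homog a := (@ishomog1 n R a (@mdeg n)).
Local Notation S := (unit_sphere R n).

Lemma formsP p : (p : mpoly n R) \in homog (2 * d).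
Proof. by case: p. Qed.

Lemma homog_cast a b (q : mpoly n R) : q \in homog a -> a = b -> q \in homog b.
Proof. by move=> ? <-. Qed.

Lemma hessian_formE p x y : hessian_form p x y =
  \sum_i \sum_j y i 0 * y j 0 * evalp (mderiv i (mderiv j p)) x.
Proof.
rewrite /hessian_form mxE exchange_big /=; apply: eq_bigr => j _.
rewrite mxE mulr_suml; apply: eq_bigr => i _; rewrite !mxE /evalp.
ring.
Qed.

Lemma hessian_form_line p x y t :
  ((line p x y)^`()^`()).[t] = hessian_form p (x + t *: y) y.
Proof.
rewrite deriv_line raddf_sum horner_sum hessian_formE exchange_big /=; apply: eq_bigr => j _.
rewrite derivM derivC mul0r add0r hornerM hornerC deriv_line horner_sum mulr_sumr.
apply: eq_bigr => i _; rewrite hornerM hornerC horner_line; ring.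
Qed.

(** With hessian_form_homog_r: a Hessian form is homogeneous of degree 2d - 2
    in x and 2 in y. *)
Lemma hessian_form_homog_l p y : exists2 q, q \in homog (2 * d - 2) &
  forall x, evalp q x = hessian_form p x y.
Proof.
exists (\sum_i \sum_j (y i 0 * y j 0) *: mderiv i (mderiv j p)).
  apply: rpred_sum => i _; apply: rpred_sum => j _; apply: rpredZ.
  apply: mderiv_homog; apply: mderiv_homog.
  by apply: (homog_cast (formsP p)); lia.
move=> x; rewrite hessian_formE /evalp raddf_sum; apply: eq_bigr => i _.
by rewrite raddf_sum; apply: eq_bigr => j _ /=; rewrite mevalZ.
Qed.

Lemma hessian_form_homog_r p x : exists2 q, q \in homog 2 &
  forall y, evalp q y = hessian_form p x y.
Proof.
exists (\sum_i \sum_j evalp (mderiv i (mderiv j p)) x *: (mpolyX R (mnm1 i) * mpolyX R (mnm1 j))).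
  apply: rpred_sum => i _; apply: rpred_sum => j _; apply: rpredZ.
  by apply: (@dhomogM _ _ _ 1 _ 1); rewrite dhomogX; apply/eqP; exact: mdeg1.
move=> y; rewrite hessian_formE {1}/evalp raddf_sum; apply: eq_bigr => i _.
rewrite raddf_sum; apply: eq_bigr => j _ /=.
by rewrite mevalZ mevalM !mevalXU mulrC.
Qed.

Lemma hessian_formD p q x y : hessian_form (p + q) x y = hessian_form p x y + hessian_form q x y.
Proof.
rewrite !hessian_formE -big_split; apply: eq_bigr => i _ /=.
rewrite -big_split; apply: eq_bigr => j _ /=.
by rewrite !mderivD /evalp mevalD mulrDr.
Qed.

Lemma hessian_formZ a p x y : hessian_form (a *: p) x y = a * hessian_form p x y.
Proof.
rewrite !hessian_formE mulr_sumr; apply: eq_bigr => i _ /=.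
rewrite mulr_sumr; apply: eq_bigr => j _ /=.
by rewrite !mderivZ /evalp mevalZ; ring.
Qed.

Lemma hessian_form0 x y : hessian_form (0 : forms R n d) x y = 0.
Proof. by rewrite -(scale0r (0 : forms R n d)) hessian_formZ mul0r. Qed.

Lemma hessian_form_lincomb D (e : 'I_D -> forms R n d) (t : D.-tuple R) x y :
  hessian_form (lincomb e t) x y = \sum_i tnth t i * hessian_form (e i) x y.
Proof.
rewrite /lincomb; elim/big_rec2: _ => [|i z q _ <-]; first exact: hessian_form0.
by rewrite hessian_formD hessian_formZ.
Qed.

Lemma form_eval_lincomb D (e : 'I_D -> forms R n d) (t : D.-tuple R) x :
  form_eval (lincomb e t) x = \sum_i tnth t i * form_eval (e i) x.
Proof.
rewrite /lincomb /form_eval; elim/big_rec2: _ => [|i z q _ <-]; first by rewrite meval0.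
by rewrite mevalD mevalZ.
Qed.

Lemma sphere_polar x : exists s u, [/\ 0 <= s, S u & x = s *: u].
Proof.
have [->|x0] := eqVneq x 0.
  exists 0, (delta_mx (Ordinal n0) 0); rewrite scale0r; split => //.
  rewrite /unit_sphere /= (bigD1 (Ordinal n0))//= big1 => [|i ij].
    by rewrite mxE !eqxx expr1n addr0.
  by rewrite mxE (negPf ij) expr0n.
pose s := Num.sqrt (\sum_i x i 0 ^+ 2).
have s2 : s ^+ 2 = \sum_i x i 0 ^+ 2 by rewrite sqr_sqrtr// sumr_ge0// => i _; exact: sqr_ge0.
have s0 : s != 0.
  rewrite -sqrf_eq0 s2; apply: contra x0 => /eqP /psumr_eq0P h.
  apply/eqP/colP => i; rewrite mxE; apply/eqP; rewrite -sqrf_eq0; apply/eqP.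
  by apply: h => // j _; exact: sqr_ge0.
exists s, (s^-1 *: x); split; first exact: sqrtr_ge0.
  rewrite /unit_sphere /=; under eq_bigr do rewrite mxE exprMn.
  by rewrite -mulr_sumr -s2 exprVn mulVf// sqrf_eq0.
by rewrite scalerA divff// scale1r.
Qed.

Lemma evalp_sphere_inj a (p : mpoly n R) : p \in homog a ->
  (forall x, S x -> evalp p x = 0) -> p = 0.
Proof.
move=> pa p0; apply: (evalp_inj pa) => x.
have [s [u [_ Su ->]]] := sphere_polar x.
by rewrite (meval_homogZ _ _ pa) p0// mulr0.
Qed.

(** Euler's identity applied twice. *)
Lemma hessian_form_diag p x : hessian_form p x x = (2 * d)%:R * (2 * d - 1)%:R * form_eval p x.
Proof.
have pd := formsP p.
rewrite hessian_formE exchange_big /= -mulrA.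
transitivity (\sum_j x j 0 * ((2 * d - 1)%:R * evalp (mderiv j p) x)).
  apply: eq_bigr => j _; rewrite -euler ?mulr_sumr; last first.
    by apply: mderiv_homog; apply: (homog_cast pd); lia.
  by apply: eq_bigr => i _; rewrite mulrA [x j 0 * _]mulrC.
rewrite mulrCA -[form_eval p x]/(evalp p x) -euler// mulr_sumr.
by apply: eq_bigr => j _; rewrite mulrCA.
Qed.

(** On the diagonal the Hessian form is a nonzero multiple of p. *)
Lemma hessian_form_inj p : (forall x y, S x -> S y -> hessian_form p x y = 0) -> p = 0.
Proof.
move=> h; apply/val_inj => /=; apply: (evalp_sphere_inj (formsP p)) => x Sx.
have := h x x Sx Sx; rewrite hessian_form_diag => /eqP.
rewrite !mulf_eq0 !pnatr_eq0 => /orP[|/eqP//]; lia.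
Qed.

Lemma hessian_form_sphere_ge0 p : (forall x y, S x -> S y -> 0 <= hessian_form p x y) ->
  forall x y, 0 <= hessian_form p x y.
Proof.
move=> h x y.
have [s [u [s0 Su ->]]] := sphere_polar x; have [s' [u' [s0' Su' ->]]] := sphere_polar y.
have [q qh qE] := hessian_form_homog_l p (s' *: u').
have [q' qh' qE'] := hessian_form_homog_r p u.
rewrite -qE (meval_homogZ _ _ qh) qE -qE' (meval_homogZ _ _ qh') qE'.
by rewrite !mulr_ge0 ?exprn_ge0//; exact: h.
Qed.

Lemma deriv2_ge0_convex (q : {poly R}) (t : R) : (forall s, 0 <= q^`()^`().[s]) ->
  0 <= t <= 1 -> q.[t] <= (1 - t) * q.[0] + t * q.[1].
Proof.
move=> q2 /andP[t0 t1].
have [->|tn0] := eqVneq t 0; first by rewrite subr0 mul1r mul0r addr0.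
have [->|tn1] := eqVneq t 1; first by rewrite subrr mul1r mul0r add0r.
have {}t0 : 0 < t by rewrite lt_neqAle eq_sym tn0.
have {}t1 : t < 1 by rewrite lt_neqAle tn1.
have mvt (r : {poly R}) a b : a < b -> exists2 c, a < c < b & r.[b] - r.[a] = r^`().[c] * (b - a).
  move=> ab.
  have h (c : R) : c \in `]a, b[ -> is_derive c (1 : R) (horner r) r^`().[c].
    by move=> _; exact: is_derive_poly.
  have hc : {within `[a, b], continuous (horner r)}.
    by apply: continuous_subspaceT => c; exact: continuous_horner.
  by have [c ci ->] := MVT ab h hc; exists c.
have [c1 /andP[_ c1t] h1] := mvt q _ _ t0.
have [c2 /andP[tc2 _] h2] := mvt q _ _ t1.
have c12 : c1 < c2 by exact: lt_trans c1t tc2.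
have [c3 _ h3] := mvt q^`() _ _ c12.
have c12' : 0 <= q^`().[c2] - q^`().[c1] by rewrite h3 mulr_ge0 ?subr_ge0 ?(ltW c12).
rewrite -subr_ge0.
have -> : (1 - t) * q.[0] + t * q.[1] - q.[t] =
  t * (q.[1] - q.[t]) - (1 - t) * (q.[t] - q.[0]) by ring.
rewrite h1 h2 (_ : _ - _ = t * (1 - t) * (q^`().[c2] - q^`().[c1])); last by ring.
by rewrite mulr_ge0// mulr_ge0 ?subr_ge0 ?(ltW t0) ?(ltW t1).
Qed.

(** Along the segment from y to x the form is a univariate polynomial whose
    second derivative is a value of the Hessian form; bihomogeneity extends
    positivity from pairs of unit vectors to all pairs. *)
Lemma hessian_ge0_convex p : (forall x y, S x -> S y -> 0 <= hessian_form p x y) ->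
  convex_function (setT : set (convex_lmodType 'cV[R]_n)) (form_eval p).
Proof.
move=> /hessian_form_sphere_ge0 h t x y xT yT.
have t01 : 0 <= t%:num <= 1 by apply/andP.
have := @deriv2_ge0_convex (line p y (x - y)) t%:num _ t01.
rewrite !horner_line scale0r addr0 scale1r [y + (x - y)]addrC subrK => h2.
rewrite -[conv t x y]/(t%:num *: (x : 'cV[R]_n) + (1 - t%:num) *: (y : 'cV[R]_n)).
have -> : t%:num *: (x : 'cV[R]_n) + (1 - t%:num) *: (y : 'cV[R]_n) = y + t%:num *: (x - y).
  by rewrite scalerBl scale1r scalerBr addrCA addrA.
rewrite -[leRHS]/(t%:num * form_eval p x + (1 - t%:num) * form_eval p y) [leRHS]addrC.
by apply: h2 => s; rewrite hessian_form_line.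
Qed.

(** Convexity between x and -x, where p takes the same value, gives p(0) <=
    p(x). *)
Lemma convex_form_ge0 p : convex_function (setT : set (convex_lmodType 'cV[R]_n)) (form_eval p) ->
  forall x, 0 <= form_eval p x.
Proof.
move=> h x.
have half : 0 <= (2^-1 : R) <= 1 by lra.
pose t : {i01 R} := Itv01 (proj1 (andP half)) (proj2 (andP half)).
have := h t x (- x) (mem_set I) (mem_set I).
rewrite -[leRHS]/(2^-1 * form_eval p x + (1 - 2^-1) * form_eval p (- x)).
rewrite -[@conv R (convex_lmodType 'cV[R]_n) t x (- x)]/(2^-1 *: x + (1 - 2^-1) *: - x).
have -> : 2^-1 *: x + (1 - 2^-1) *: - x = (0 : R) *: x.
  by rewrite scalerN -scaleNr -scalerDl; congr (_ *: _); lra.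
have E z : form_eval p z = evalp p z by [].
rewrite -[- x]scaleN1r !E !(meval_homogZ _ _ (formsP p)).
rewrite [(-1) ^+ _]exprM sqrrN !expr1n mul1r expr0n muln_eq0 /=.
by rewrite (gtn_eqF d0) mul0r; lra.
Qed.

Lemma radial_homog : (\sum_i mpolyX R (mnm1 i) ^+ 2) ^+ d \in homog (2 * d).
Proof.
apply: dhomogMn; apply: rpred_sum => i _.
rewrite -[X in _ \in homog X]mul1n; apply: dhomogMn.
by rewrite dhomogX; apply/eqP; exact: mdeg1.
Qed.

(** The form |x|^(2d), equal to 1 on the sphere. *)
Definition radial : forms R n d := DHomog radial_homog.

Lemma radialE x : form_eval radial x = (\sum_i x i 0 ^+ 2) ^+ d.
Proof.
rewrite /form_eval /= rmorphXn raddf_sum; congr (_ ^+ d); apply: eq_bigr => i _.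
by rewrite /= rmorphXn /= mevalXU.
Qed.

(** On the line from x with direction y, both unit, the form is (1 + 2ct +
    t^2)^d with c the scalar product of x and y; its second derivative at 0
    is 2d + 4d(d - 1)c^2. *)
Lemma radial_hessian x y : S x -> S y -> (2 * d)%:R <= hessian_form radial x y.
Proof.
move=> Sx Sy.
rewrite (_ : x = x + 0 *: y) -?hessian_form_line; last by rewrite scale0r addr0.
rewrite /radial /=.
set P := \sum_i _.
pose c := \sum_i x i 0 * y i 0.
have qE : line P x y = 1 + (2 * c)%:P * 'X + 'X^2.
  rewrite /P /line raddf_sum /=.
  transitivity (\sum_i ((x i 0 ^+ 2)%:P + (2 * (x i 0 * y i 0))%:P * 'X + (y i 0 ^+ 2)%:P * 'X^2)).
    apply: eq_bigr => i _; rewrite rmorphXn /= mmapX mmap1U.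
    rewrite !polyCM polyC_natr; ring.
  rewrite !big_split /= -!mulr_suml -!raddf_sum /= -mulr_sumr.
  rewrite (_ : \sum_i x i 0 ^+ 2 = 1)// (_ : \sum_i y i 0 ^+ 2 = 1)//.
  by rewrite mul1r.
rewrite (_ : line _ x y = (line P x y) ^+ d); last by rewrite /line rmorphXn.
have [e ->] : exists e, d = e.+1 by exists d.-1; rewrite prednK.
rewrite qE.
set q := _ + 'X^2.
have q0 : q.[0] = 1 by rewrite /q !hornerE expr0n !addr0.
have q1 : q^`() = (2 * c)%:P + 'X *+ 2.
  by rewrite /q !derivD derivM derivX derivXn -polyC1 !derivC mul0r !add0r mulr1 expr1.
have q2 : q^`()^`() = 2%:R%:P by rewrite q1 derivD derivC derivMn derivX add0r polyC_natr.
rewrite deriv_exp /= derivMn derivM deriv_exp q2 -/q.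
rewrite hornerMn hornerD !hornerM hornerMn !hornerM !horner_exp q0 !expr1n hornerC !mulr1.
rewrite natrM -[leRHS]mulr_natr ler_wpM2r//.
by rewrite lerDl mulrnAr mulrn_wge0// -expr2 sqr_ge0.
Qed.

End Hessian.

(** * Transitivity of rotations on the sphere *)

Section Rotations.
Context {R : realType}.

(** Factor the same bordered matrix in two ways, by eliminating either block. *)
Lemma det_1_add_rank1 n (a : 'cV[R]_n) (b : 'rV[R]_n) :
  \det (1%:M - a *m b) = 1 - ((b *m a) 0 0).
Proof.
have e1 : block_mx (1%:M : 'M[R]_1) 0 a 1%:M *m block_mx 1%:M b 0 (1%:M - a *m b) =
   block_mx 1%:M b a 1%:M.
  by rewrite mulmx_block !(mul1mx, mul0mx, mulmx1, mulmx0, addr0, add0r) addrC subrK.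
have e2 : block_mx (1%:M - b *m a : 'M[R]_1) b 0 1%:M *m block_mx 1%:M 0 a 1%:M =
   block_mx 1%:M b a 1%:M.
  by rewrite mulmx_block !(mul1mx, mul0mx, mulmx1, mulmx0, addr0, add0r) subrK.
have := congr1 determinant (etrans e1 (esym e2)).
rewrite !det_mulmx !det_lblock !det_ublock !det1 !mul1r !mulr1 => ->.
by rewrite [X in \det X]mx11_scalar det_scalar1 !mxE eqxx.
Qed.

Definition reflection n (w : 'cV[R]_n) : 'M[R]_n :=
  1%:M - (2 / (w^T *m w) 0 0) *: (w *m w^T).

Let dot_scale n (w : 'cV[R]_n) (c : R) : (w^T *m (c *: w)) 0 0 = c * (w^T *m w) 0 0.
Proof. by rewrite -scalemxAr mxE. Qed.

Lemma dot_gt0 n (w : 'cV[R]_n) : w != 0 -> 0 < (w^T *m w) 0 0.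
Proof.
move=> w0.
have wE : (w^T *m w) 0 0 = \sum_i w i 0 ^+ 2.
  by rewrite mxE; apply: eq_bigr => i _; rewrite mxE expr2.
rewrite wE lt_neqAle eq_sym sumr_ge0 ?andbT => [|i _]; last exact: sqr_ge0.
apply: contra w0 => /eqP /psumr_eq0P h; apply/eqP/colP => i.
by rewrite mxE; apply/eqP; rewrite -sqrf_eq0 h// => j _; exact: sqr_ge0.
Qed.

Lemma reflection_det n (w : 'cV[R]_n) : w != 0 -> \det (reflection w) = -1.
Proof.
move=> w0; rewrite /reflection scalemxAl det_1_add_rank1 dot_scale.
by rewrite divfK ?gt_eqF ?dot_gt0//; lra.
Qed.

Lemma reflection_orth n (w : 'cV[R]_n) : w != 0 -> (reflection w)^T *m reflection w = 1%:M.
Proof.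
move=> w0; have h : (w^T *m w) 0 0 != 0 by rewrite gt_eqF ?dot_gt0.
have -> : (reflection w)^T = reflection w.
  by rewrite /reflection [LHS]linearB /= [in LHS]linearZ /= trmx1 trmx_mul trmxK.
rewrite /reflection; set c := 2 / _; have ch : c * (w^T *m w) 0 0 = 2 by rewrite divfK.
rewrite mulmxBl mul1mx mulmxBr mulmx1 -scalemxAl -scalemxAr.
rewrite -mulmxA (mulmxA w^T) [w^T *m w]mx11_scalar mul_scalar_mx -!scalemxAr.
by rewrite !scalerA ch mulr2n mulrDr mulr1 scalerDl opprB addrK subrK.
Qed.

Lemma reflectionE n (w u : 'cV[R]_n) :
  reflection w *m u = u - (2 * (w^T *m u) 0 0 / (w^T *m w) 0 0) *: w.
Proof.
rewrite /reflection mulmxBl mul1mx -scalemxAl -mulmxA [w^T *m u]mx11_scalar.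
by rewrite mul_mx_scalar scalerA [in RHS]mxE mulr1n mulrAC.
Qed.

(** The reflection along u - v exchanges u and v; composing it with a
    reflection along a vector orthogonal to v, which exists in dimension at
    least 2, restores the orientation. *)
Lemma rotation_transitive n (u v : 'cV[R]_n) : (2 <= n)%N ->
  \sum_i u i 0 ^+ 2 = 1 -> \sum_i v i 0 ^+ 2 = 1 ->
  exists2 Q : 'M[R]_n, is_rotation Q & Q *m u = v.
Proof.
move=> n2 u1 v1.
have [<-|uv] := eqVneq u v.
  by exists 1%:M; [split; rewrite ?trmx1 ?mul1mx ?det1|rewrite mul1mx].
have [w w0 wv] : exists2 w : 'cV[R]_n, w != 0 & w^T *m v = 0.
  have : kermx v != 0.
    by rewrite -mxrank_eq0 mxrank_ker; have := rank_leq_col v; lia.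
  move=> /rowV0Pn[r /sub_kermxP rv r0]; exists r^T; last by rewrite trmxK.
  by rewrite trmx_eq0.
have uv0 : u - v != 0 by rewrite subr_eq0.
exists (reflection w *m reflection (u - v)).
  split; last by rewrite det_mulmx !reflection_det// mulrNN mulr1.
  by rewrite trmx_mul mulmxA -(mulmxA _ _ (reflection w)) reflection_orth// mulmx1 reflection_orth.
rewrite -mulmxA [reflection (u - v) *m u]reflectionE.
have dotE (a : 'cV[R]_n) : (a^T *m a) 0 0 = \sum_i a i 0 ^+ 2.
  by rewrite mxE; apply: eq_bigr => i _; rewrite mxE expr2.
have uu : (u^T *m u) 0 0 = 1 by rewrite dotE.
have vv : (v^T *m v) 0 0 = 1 by rewrite dotE.
have vu : (v^T *m u) 0 0 = (u^T *m v) 0 0.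
  by rewrite !mxE; apply: eq_bigr => i _; rewrite !mxE mulrC.
have hd := dot_gt0 uv0.
have -> : 2 * ((u - v)^T *m u) 0 0 / ((u - v)^T *m (u - v)) 0 0 = 1.
  apply: (@mulIf _ (((u - v)^T *m (u - v)) 0 0)); first by rewrite gt_eqF.
  have tB : (u - v)^T = u^T - v^T by exact: linearB.
  have eB (A B : 'M[R]_1) : (A - B) 0 0 = A 0 0 - B 0 0 by rewrite !mxE.
  by rewrite mul1r divfK ?gt_eqF// tB mulmxBr !mulmxBl !eB; lra.
by rewrite scale1r opprB addrC subrK reflectionE wv mxE mulr0 mul0r scale0r subr0.
Qed.

End Rotations.

(** * Forms on the sphere under a rotation-invariant measure *)

Section SphereMeasure.
Context {R : realType} {n : nat}.
Local Notation S := (unit_sphere R n).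
Local Notation B := (borelRn R n).
Local Notation homog a := (@ishomog1 n R a (@mdeg n)).

Lemma measurable_coord i : measurable_fun setT (fun x : B => (x : 'cV[R]_n) i 0).
Proof.
move=> mT; apply: (measurability _ (RGenOpens.measurableE R)) => // _ [_ [a [b ->]] <-].
rewrite setTI; apply: sub_sigma_algebra.
have /continuousP := @coord_continuous R n 1 i 0.
by apply; exact: interval_open.
Qed.

Lemma measurable_evalp (p : mpoly n R) : measurable_fun setT (evalp p : B -> R).
Proof.
rewrite /evalp /meval /mmap; apply: measurable_sum => m.
apply: (@measurable_funM _ B R setT); first exact: measurable_cst.
apply: measurable_prod => i _; apply: (@measurable_funX _ B R).
exact: measurable_coord.
Qed.

Lemma measurable_sphere : measurable S.
Proof.
have mf : measurable_fun setT (fun x : B => \sum_i (x : 'cV[R]_n) i 0 ^+ 2).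
  by apply: measurable_sum => i; apply: (@measurable_funX _ B R); exact: measurable_coord.
have := mf measurableT [set 1] (measurable_set1 1).
by rewrite setTI.
Qed.

(** The Borel sets of vectors are generated by the open sets, so this is the
    continuity of matrix multiplication. *)
Lemma measurable_mulmxl (Q : 'M[R]_n) : measurable_fun setT (fun x : B => (Q *m x : B)).
Proof.
suff cQ : continuous (fun x : 'cV[R]_n => Q *m x).
  move=> mT; apply: (@measurability _ _ B B setT _ (@open 'cV[R]_n)) => // _ [A oA <-].
  by rewrite setTI; apply: sub_sigma_algebra; move/continuousP : cQ; exact.
move=> x A [P xP PA].
have cc i j : continuous (fun y : 'cV[R]_n => (Q *m y) i j).
  have -> : (fun y : 'cV[R]_n => (Q *m y) i j) = (fun y => \sum_k Q i k * y k j).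
    by apply/funext => y; rewrite mxE.
  elim: (index_enum _) => [|k r IH].
    by under eq_fun do rewrite big_nil; exact: cst_continuous.
  under eq_fun do rewrite big_cons.
  have c1 : continuous (fun y : 'cV[R]_n => Q i k * y k j).
    move=> z; apply: (@cvgM R 'cV[R]_n (nbhs z) _ (cst (Q i k)) (fun y => y k j)).
      exact: cvg_cst.
    exact: coord_continuous.
  move=> z.
  exact: (@cvgD R R 'cV[R]_n (nbhs z) _ _ _ _ _ (c1 z) (IH z)).
have h := @filter_forall 'cV[R]_n ('I_n * 'I_1)%type
  (fun k y => P k.1 k.2 ((Q *m y) k.1 k.2)) (nbhs x) _ (fun k => cc k.1 k.2 x _ (xP k.1 k.2)).
suff : nbhs x ((fun y : 'cV[R]_n => Q *m y) @^-1` A) by [].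
have F : Filter (nbhs (x : 'cV[R]_n)) by exact: nbhs_filter.
by apply: filterS (h F) => y yP; apply: PA => i j; exact: (yP (i, j)).
Qed.

Lemma sphere_coord_le1 x i : S x -> `|(x : 'cV[R]_n) i 0| <= 1.
Proof.
rewrite /unit_sphere /= => Sx; rewrite -[_ <= _]ler_sqr ?nnegrE// expr1n real_normK ?num_real//.
rewrite -Sx (bigD1 i)//= lerDl; apply: sumr_ge0 => j _; exact: sqr_ge0.
Qed.

Lemma evalp_bounded (p : mpoly n R) : exists C, forall x, S x -> `|evalp p x| <= C.
Proof.
exists (\sum_(m <- msupp p) `|mcoeff m p|) => x Sx.
rewrite /evalp /meval /mmap; apply: le_trans (ler_norm_sum _ _ _) _; apply: ler_sum => m _.
rewrite normrM ler_piMr// /mmap1 normr_prod; apply: prodr_ile1 => i _.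
by rewrite normr_ge0 /= normrX exprn_ile1//; exact: sphere_coord_le1.
Qed.

Variable sigma : probability B R.

Lemma integrable_evalp (p : mpoly n R) : sigma.-integrable S (EFin \o (evalp p : B -> R)).
Proof.
have [C HC] := evalp_bounded p.
apply: measurable_bounded_integrable.
- exact: measurable_sphere.
- exact: le_lt_trans (probability_le1 _ measurable_sphere) (ltry 1).
- exact: measurable_funTS (measurable_evalp p).
- by exists C; split; [exact: num_real|move=> M CM x /HC /le_trans; apply; exact: ltW].
Qed.

Hypothesis hsigma : rotation_invariant_on_sphere sigma.

Lemma rotation_sphere (Q : 'M[R]_n) x : is_rotation Q -> S (Q *m x) <-> S x.
Proof.
move=> [QQ _].
have dotE (a : 'cV[R]_n) : \sum_i a i 0 ^+ 2 = (a^T *m a) 0 0.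
  by rewrite mxE; apply: eq_bigr => i _; rewrite mxE expr2.
by rewrite /unit_sphere /= !dotE trmx_mul mulmxA -(mulmxA _ _ Q) QQ mulmx1.
Qed.

Lemma integral_rotation (Q : 'M[R]_n) (f : B -> R) : is_rotation Q ->
  measurable_fun setT f -> (forall x, 0 <= f x) ->
  \int[sigma]_(x in S) f (Q *m x) = \int[sigma]_(x in S) f x.
Proof.
move=> rQ mf f0; congr fine.
have E : (fun x : B => (Q *m x : B)) @^-1` S = S.
  by apply/seteqP; split => x /=; rewrite (rotation_sphere x rQ).
have mf' : measurable_fun S (EFin \o f).
  by apply: measurable_funTS; exact: (measurableT_comp (@EFin_measurable R setT) mf).
have := @ge0_integral_pushforward _ _ _ _ R (fun x : B => (Q *m x : B)) (measurable_mulmxl Q) sigma S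
  (EFin \o f) measurable_sphere mf' (fun x _ => f0 x).
rewrite E => <-.
apply: eq_measure_integral => [|mQ A mA _]; first exact: measurable_mulmxl.
exact: (hsigma.2 Q rQ A mA).
Qed.

End SphereMeasure.

(** Indexing a basis by an ordinal, instead of using the vector space
    structure on forms, makes its cardinal visible as a binomial coefficient
    and gives access to Gram matrices. *)
Lemma homog_basis (R : realType) (m a : nat) :
  exists b : 'I_('C(a + m, a)) -> mpoly m.+1 R,
  [/\ forall c : 'rV[R]_('C(a + m, a)), \sum_i c 0 i *: b i \in ishomog1 a (@mdeg m.+1),
      forall p, p \in ishomog1 a (@mdeg m.+1) ->
        exists c : 'rV[R]_('C(a + m, a)), p = \sum_i c 0 i *: b i &
      forall c : 'rV[R]_('C(a + m, a)), \sum_i c 0 i *: b i = 0 -> c = 0].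
Proof.
have [f flin [g fK gK]] := dhomog_vecaxiom m R a.
pose F := GRing.isLinear.Build R (dhomog m.+1 R a) 'rV[R]_('C(a + m, a)) _ f flin.
pose f' : {linear dhomog m.+1 R a -> 'rV[R]_('C(a + m, a))} := HB.pack f F.
pose b i : mpoly m.+1 R := mpoly_of_dhomog (g (delta_mx 0 i)).
have gE c : mpoly_of_dhomog (g c) = \sum_i c 0 i *: b i.
  have -> : g c = \sum_i c 0 i *: g (delta_mx 0 i).
    apply: (can_inj fK); rewrite gK -[f _]/(f' _) linear_sum /=.
    rewrite {1}[c]row_sum_delta; apply: eq_bigr => i _.
    by rewrite -[f _]/(f' _) linearZ /= gK.
  by rewrite raddf_sum.
exists b; split.
- by move=> c; rewrite -gE; case: (g c).
- by move=> p pa; exists (f (DHomog pa)); rewrite -gE fK.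
- move=> c; rewrite -gE => g0.
  rewrite -[c]gK (_ : g c = 0); last exact: val_inj.
  by rewrite -[f _]/(f' _) linear0.
Qed.

Section FormBound.
Context {R : realType} {n : nat} (sigma : probability (borelRn R n) R).
Hypotheses (n2 : (2 <= n)%N) (hsigma : rotation_invariant_on_sphere sigma).
Local Notation S := (unit_sphere R n).
Local Notation homog a := (@ishomog1 n R a (@mdeg n)).

(** An instance of homogeneous_sup_bound: forms of degree a are determined by
    their values on the sphere, and composing with a rotation maps forms to
    forms isometrically. *)
Theorem form_sup_bound a (p : mpoly n R) (x : 'cV[R]_n) : p \in homog a -> S x ->
  evalp p x ^+ 2 <= ('C(n + a - 1, a))%:R * \int[sigma]_(y in S) (evalp p y ^+ 2).
Proof.
case: n n2 sigma hsigma p x => // m m2 sg hs p x pa Sx.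
have [b [bh bs bf]] := homog_basis R m a.
have -> : (m.+1 + a - 1 = a + m)%N by lia.
pose bb i : borelRn R m.+1 -> R := evalp (b i).
have evE c y : comb bb c y = evalp (\sum_i c 0 i *: b i) y.
  by rewrite /comb /bb /evalp raddf_sum; apply: eq_bigr => i _; rewrite /= mevalZ.
have [c cE] := bs _ pa.
have := @homogeneous_sup_bound R _ (borelRn R m.+1) sg (unit_sphere R m.+1) _
  bb measurable_sphere hs.1 _ _ _ c x Sx.
have ib i j : sg.-integrable (unit_sphere R m.+1) (EFin \o (fun y => bb i y * bb j y)).
  rewrite (_ : _ \o _ = EFin \o evalp (b i * b j)); first exact: integrable_evalp.
  by apply/funext => y /=; rewrite /evalp mevalM.
move=> /(_ ib) H.
have -> : evalp p x = comb bb c x by rewrite evE -cE.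
have -> : \int[sg]_(y in unit_sphere R m.+1) (evalp p y ^+ 2) =
    \int[sg]_(y in unit_sphere R m.+1) (comb bb c y ^+ 2).
  by apply: eq_Rintegral => y _; rewrite evE -cE.
apply: H.
  move=> c' c'0; apply: bf; apply: (evalp_sphere_inj _ (bh c')) => // y Sy.
  by rewrite -evE; exact: c'0.
move=> u v Su Sv.
have [Q rQ <-] := rotation_transitive m2 Su Sv.
exists (fun y : borelRn R m.+1 => (Q *m y : borelRn R m.+1)); split => // c'.
have [q qa qE] := comp_linear_homog Q (bh c').
have [c'' c''E] := bs _ qa.
exists c''; split; first by move=> y; rewrite !evE -c''E qE.
rewrite -!(Rintegral_combM measurable_sphere ib).
rewrite -[RHS](integral_rotation hs rQ).
- by apply: eq_Rintegral => y _; rewrite !evE -c''E qE.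
- have mc : measurable_fun setT (comb bb c').
    by rewrite (_ : comb bb c' = evalp (\sum_i c' 0 i *: b i));
      [exact: measurable_evalp|apply/funext => y; exact: evE].
  exact: (@measurable_funM _ (borelRn R m.+1) R setT).
- by move=> y; rewrite -expr2 sqr_ge0.
Qed.

End FormBound.

(** * Binomial estimates and the numerical constant *)

Section Numerics.
Context {R : realType}.

(** One term of the binomial expansion of (1 + x)^(m + a). *)
Lemma binomial_le (m a : nat) (x : R) : 0 < x ->
  'C(m + a, a)%:R <= x^-1 ^+ m * (1 + x) ^+ (m + a).
Proof.
move=> x0; rewrite exprVn mulrC ler_pdivlMr ?exprn_gt0//.
rewrite -(bin_sub (leq_addl m a)) addnK exprDn.
rewrite (bigD1 (inord m : 'I_(m + a).+1))//= inordK ?ltnS ?leq_addr//.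
rewrite expr1n mul1r -[X in _ <= X + _]mulr_natl lerDl; apply: sumr_ge0 => i _.
by rewrite expr1n mul1r mulrn_wge0// exprn_ge0// ltW.
Qed.

Variables (n d : nat).
Hypotheses (n2 : (2 <= n)%N) (d0 : (0 < d)%N).
Let L : R := ln (2 * d%:R + 1).

Let d1 : 1 <= d%:R :> R. Proof. by rewrite ler1n. Qed.

Lemma ln_ge_half : 2^-1 <= L.
Proof.
have hd := d1; have hd1 : 0 < 2 * d%:R + 1 :> R by lra.
suff h : expR (2^-1 : R) <= 2 * d%:R + 1.
  by rewrite /L -[leLHS]expRK ler_ln ?posrE ?expR_gt0.
have h := expR_ge1Dx (- 2^-1 : R); rewrite expRN in h.
have e0 := expR_gt0 (2^-1 : R).
have e1 : expR (2^-1 : R) * (expR 2^-1)^-1 = 1 by rewrite divff ?gt_eqF.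
have : expR (2^-1 : R) <= 2 by nra.
lra.
Qed.

Variables (D Dbi : nat).
Hypotheses (D0 : (0 < D)%N) (Dbi0 : (0 < Dbi)%N).

(** The right-hand side of the theorem, with the two dimensions left free. *)
Definition convex_volume_bound : R := 2 * d%:R / (9 * expR 1 ^+ 2 * Num.sqrt (2 * n%:R * L))
     * Num.sqrt (D%:R / Dbi%:R).

Lemma convex_volume_bound_gt0 : 0 < convex_volume_bound.
Proof.
have L0 : 0 < L by have := ln_ge_half; lra.
have nn : 0 < n%:R :> R by rewrite ltr0n; lia.
have hd := d1; have dd : 0 < d%:R :> R by lra.
have q0 : 0 < D%:R / Dbi%:R :> R by rewrite divr_gt0 ?ltr0n.
rewrite /convex_volume_bound mulr_gt0 ?sqrtr_gt0//.
by rewrite !(divr_gt0, mulr_gt0, exprn_gt0, expR_gt0, sqrtr_gt0).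
Qed.

Variable k : nat.
Hypotheses (kL : n%:R * L <= k%:R) (kU : k%:R <= 2 * n%:R * L).

Let m := n.-1.
Let nE : n = m.+1. Proof. by rewrite /m prednK//; lia. Qed.

Let n_le_2k : n%:R <= 2 * k%:R :> R.
Proof.
apply: le_trans (_ : 2 * (n%:R * L) <= _); last by rewrite ler_wpM2l.
by rewrite mulrCA ler_peMr ?ler0n//; have := ln_ge_half; lra.
Qed.

Let k0 : (0 < k)%N.
Proof.
have hn : 0 < n%:R :> R by rewrite ltr0n; lia.
by rewrite -(ltr0n R); have := n_le_2k; lra.
Qed.

Let pow_le : (2 * d%:R + 1) ^+ m <= expR 1 ^+ k :> R.
Proof.
have hd := d1; have h : 0 < 2 * d%:R + 1 :> R by lra.
apply: (@le_trans _ _ ((2 * d%:R + 1) ^+ n)).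
  by rewrite ler_weXn2l ?nE//; lra.
rewrite -expRM_natr mul1r -[X in X ^+ n]lnK ?posrE// -expRM_natl.
by rewrite ler_expR.
Qed.

(** The dimension of the space of biforms of bidegree (2d - 2)k and 2k, which
    contains the k-th powers of Hessian forms. *)
Definition biform_dim : nat :=
  'C(n + (2 * d - 2) * k - 1, (2 * d - 2) * k) * 'C(n + 2 * k - 1, 2 * k).

(** The first binomial coefficient is bounded with x = 1/(2d) in binomial_le,
    by (2d)^m e^((m + a)/2d), the second with x = 1/2, by 3^m (9/4)^k. As m
    <= n, the choice of k makes (2d + 1)^m at most e^k, and m <= 2k. *)
Lemma biform_dim_le : biform_dim%:R <= (expR 1 ^+ 3 * (9 / 4)) ^+ k :> R.
Proof.
have hd := d1; have dd : 0 < d%:R :> R by lra.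
have nmE a : (n + a - 1 = m + a)%N by rewrite nE addSn subn1.
have E0 : 0 <= expR 1 ^+ k :> R by rewrite exprn_ge0// expR_ge0.
have mk : m%:R <= 2 * k%:R :> R by apply: le_trans n_le_2k; rewrite ler_nat nE.
have b1 : 'C(n + (2 * d - 2) * k - 1, (2 * d - 2) * k)%:R <= expR 1 ^+ k * expR 1 ^+ k :> R.
  have -> : (n + (2 * d - 2) * k - 1 = m + (2 * d - 2) * k)%N by exact: nmE.
  have x0 : 0 < (2 * d%:R)^-1 :> R by rewrite invr_gt0; lra.
  apply: le_trans (binomial_le m _ x0) _; rewrite invrK.
  apply: ler_pM; rewrite ?exprn_ge0//; try lra.
    by apply: le_trans pow_le; rewrite lerXn2r ?nnegrE; lra.
  apply: (@le_trans _ _ (expR (2 * d%:R)^-1 ^+ (m + (2 * d - 2) * k))).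
    by rewrite lerXn2r ?nnegrE ?expR_ge0 ?expR_ge1Dx//; lra.
  rewrite -!expRM_natl ler_expR mulr1 ler_pdivrMr; last by lra.
  rewrite natrD natrM natrB; last by lia.
  by rewrite natrM; lra.
have b2 : 'C(n + 2 * k - 1, 2 * k)%:R <= expR 1 ^+ k * (9 / 4) ^+ k :> R.
  have -> : (n + 2 * k - 1 = m + 2 * k)%N by exact: nmE.
  have x0 : 0 < 2^-1 :> R by lra.
  apply: le_trans (binomial_le m _ x0) _; rewrite invrK exprD mulrA -exprMn.
  have -> : 2 * (1 + 2^-1) = 3 :> R by lra.
  rewrite [(1 + 2^-1) ^+ (2 * k)]exprM; have -> : (1 + 2^-1) ^+ 2 = 9 / 4 :> R by lra.
  apply: ler_wpM2r; first by rewrite exprn_ge0//; lra.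
  by apply: le_trans pow_le; rewrite lerXn2r ?nnegrE; lra.
rewrite /biform_dim natrM; apply: le_trans (ler_pM _ _ b1 b2) _; rewrite ?ler0n//.
rewrite -!exprMn (_ : expR 1 * expR 1 * (expR 1 * (9 / 4)) = expR 1 ^+ 3 * (9 / 4) :> R)//; ring.
Qed.

(** The factors D, Dbi and 2d cancel; with k <= 2nL and biform_dim_le what
    remains is 4 (1/(9e))^k <= 1. *)
Lemma numeric_bound :
  (convex_volume_bound * (Num.sqrt 2 * expR 2^-1)) ^+ (2 * k) *
   (biform_dim%:R * (2 * (2 * (k%:R * Dbi%:R / (D%:R / 2 * expR 1)) ^+ k)))
  <= (2 * d%:R) ^+ (2 * k).
Proof.
have L0 : 0 < L by have := ln_ge_half; lra.
have nn : 0 < n%:R :> R by rewrite ltr0n; lia.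
have hd := d1; have dd : 0 < d%:R :> R by lra.
have DD : 0 < D%:R :> R by rewrite ltr0n.
have BB : 0 < Dbi%:R :> R by rewrite ltr0n.
have kk : 0 < k%:R :> R by rewrite ltr0n.
set E := expR 1.
have E2 : 2 <= E by have := expR_ge1Dx (1 : R); rewrite /E; lra.
have e2 : expR (2^-1 : R) ^+ 2 = E by rewrite -expRM_natl mulfV ?pnatr_eq0.
have s2 : (convex_volume_bound * (Num.sqrt 2 * expR 2^-1)) ^+ 2 =
    (2 * d%:R) ^+ 2 * (2 * E * D%:R / (81 * E ^+ 4 * (2 * n%:R * L) * Dbi%:R)).
  rewrite /convex_volume_bound -/E !exprMn exprVn !exprMn.
  rewrite !sqr_sqrtr ?divr_ge0 ?mulr_ge0 ?ler0n ?(ltW L0)//.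
  rewrite e2.
  by field; rewrite !gt_eqF//; lra.
rewrite exprM s2 [(2 * d%:R) ^+ (2 * k)]exprM.
have := sqr_ge0 (2 * d%:R : R); set b := _ ^+ 2 => b0.
rewrite exprMn -[leLHS]mulrA; apply: ler_piMr; first by rewrite exprn_ge0.
set A := _ / (81 * _ * _ * _); set C := _ / (D%:R / 2 * E).
have AC : A * C = 4 / (81 * E ^+ 4) * (k%:R / (2 * n%:R * L)).
  by rewrite /A /C; field; rewrite !gt_eqF//; lra.
have kr : 0 <= k%:R / (2 * n%:R * L) <= 1.
  rewrite divr_ge0 ?mulr_ge0 ?ler0n ?(ltW L0)//=.
  by rewrite ler_pdivrMr ?mulr_gt0// mul1r.
have A0 : 0 <= A by rewrite /A divr_ge0 ?mulr_ge0 ?exprn_ge0 ?ler0n ?(ltW L0)//; lra.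
have C0 : 0 <= C by rewrite /C divr_ge0 ?mulr_ge0 ?ler0n//; lra.
have P0 : 0 < E ^+ 4 by rewrite exprn_gt0//; lra.
have F0 : 0 <= 4 / (81 * E ^+ 4) by rewrite divr_ge0// ?mulr_ge0 ?(ltW P0)//; lra.
apply: (@le_trans _ _ (4 * (9 * E)^-1 ^+ k)); last first.
  have h0 : 0 <= (9 * E)^-1 by rewrite invr_ge0; lra.
  have h1 : (9 * E)^-1 <= 4^-1 by rewrite lef_pV2 ?posrE; lra.
  have : (9 * E)^-1 ^+ k <= (9 * E)^-1 ^+ 1.
    by apply: ler_wiXn2l => //; apply: le_trans h1 _; lra.
  by rewrite expr1; lra.
have -> : (9 * E)^-1 = E ^+ 3 * (9 / 4) * (4 / (81 * E ^+ 4)).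
  by field; rewrite gt_eqF//; lra.
have -> : A ^+ k * (biform_dim%:R * (2 * (2 * C ^+ k))) = 4 * (biform_dim%:R * (A * C) ^+ k).
  by rewrite [(A * C) ^+ k]exprMn; ring.
rewrite [X in _ <= _ * X]exprMn; apply: ler_wpM2l => //.
have AC0 : 0 <= A * C by exact: mulr_ge0.
case/andP: kr => kr0 kr1.
apply: ler_pM => //; [exact: exprn_ge0|exact: biform_dim_le|].
by rewrite lerXn2r ?nnegrE// AC ler_piMr.
Qed.

End Numerics.

(** The factor sqrt(2) e^(1/2) compensates for the losses of
    power_sublevel_volume: its D-th power is 2^(D/2) e^(D/2), at least 2
    e^(D/2) when D >= 2. *)
Lemma root_lower_bound (R : realType) (D : nat) (f r : R) : (1 < D)%N -> 0 < f ->
  (f * (Num.sqrt 2 * expR 2^-1)) ^+ D * (expR (- (D%:R / 2)) / 2) <= r ->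
  f <= r `^ (D%:R^-1).
Proof.
move=> D1 f0 H.
have r0 : f ^+ D <= r.
  apply: le_trans H.
  have -> : expR (- (D%:R / 2)) = (expR (2^-1 : R) ^+ D)^-1 by rewrite -expRM_natl expRN.
  have hD : expR (2^-1 : R) ^+ D != 0 by rewrite gt_eqF ?exprn_gt0 ?expR_gt0.
  rewrite !exprMn.
  have -> : f ^+ D * (Num.sqrt 2 ^+ D * expR 2^-1 ^+ D) * ((expR 2^-1 ^+ D)^-1 / 2) =
    f ^+ D * (Num.sqrt 2 ^+ D / 2) by field.
  apply: ler_peMr; first by rewrite exprn_ge0// ltW.
  have s21 : 1 <= Num.sqrt 2 :> R by rewrite -[leLHS]sqrtr1 ler_wsqrtr//; lra.
  by rewrite ler_pdivlMr// mul1r -[leLHS](@sqr_sqrtr R 2)// ler_weXn2l.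
have -> : f = (f ^+ D) `^ (D%:R^-1).
  by rewrite -powR_mulrn ?(ltW f0)// -powRrM mulfV ?powRr1 ?(ltW f0)// pnatr_eq0; lia.
by apply: ge0_ler_powR; rewrite ?invr_ge0 ?ler0n ?nnegrE ?exprn_ge0 ?(ltW f0)//;
  apply: le_trans r0; rewrite exprn_ge0 ?(ltW f0).
Qed.

Lemma dim_mean_zero_gt1 n d : (2 <= n)%N -> (1 <= d)%N -> (1 < dim_mean_zero n d)%N.
Proof.
move=> n2 d1; rewrite /dim_mean_zero.
have : ('C(1 + 2 * d, 2 * d) <= 'C(n + 2 * d - 1, 2 * d))%N by apply: leq_bin2l; lia.
by rewrite addnC addn1 binSn; lia.
Qed.

Lemma dim_biforms_gt0 n d : (2 <= n)%N -> (1 <= d)%N -> (0 < dim_biforms n d)%N.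
Proof. by move=> n2 d1; rewrite /dim_biforms muln_gt0 !bin_gt0; lia. Qed.

(** * Sup bounds for Hessian forms on pairs of unit vectors *)

Section BiformBound.
Context {R : realType} {n d : nat} (sigma : probability (borelRn R n) R).
Hypotheses (n2 : (2 <= n)%N) (d0 : (0 < d)%N) (hsigma : rotation_invariant_on_sphere sigma).
Local Notation S := (unit_sphere R n).
Local Notation B := (borelRn R n).
Local Notation homog a := (@ishomog1 n R a (@mdeg n)).
Local Notation SS := (S `*` S : set (B * B)%type).
Local Notation mu := (sigma \x sigma)%E.

Lemma measurable_SS : measurable SS.
Proof. exact (@measurableX _ _ B B S S (@measurable_sphere R n) (@measurable_sphere R n)). Qed.

Lemma mu_SS : mu SS = 1%E.
Proof.
have [h1 _] := hsigma.
have mS := @measurable_sphere R n.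
transitivity (sigma S * sigma S)%E; last by rewrite h1 mule1.
exact (@product_measure1E _ _ B B R sigma sigma S S mS mS).
Qed.

(** The Hessian form on the product space that carries the product measure. *)
Definition hess (p : forms R n d) (z : B * B) : R := hessian_form p z.1 z.2.

Lemma measurable_hess p : measurable_fun setT (hess p).
Proof.
rewrite (_ : hess p = fun z : B * B => \sum_i \sum_j (z.2 : 'cV[R]_n) i 0 * (z.2 : 'cV[R]_n) j 0 *
   evalp (mderiv i (mderiv j p)) z.1); last by apply/funext => z; exact: hessian_formE.
have mc i : measurable_fun setT (fun z : B * B => (z.2 : 'cV[R]_n) i 0).
  by apply: (measurableT_comp (measurable_coord i)); exact: measurable_snd.
apply: measurable_sum => i; apply: measurable_sum => j.
apply: (@measurable_funM _ (B * B)%type R setT).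
  exact: (@measurable_funM _ (B * B)%type R setT).
by apply: (measurableT_comp (measurable_evalp _)); exact: measurable_fst.
Qed.

Lemma hess_bounded p : exists C, forall z, SS z -> `|hess p z| <= C.
Proof.
have H i j := evalp_bounded (mderiv i (mderiv j p)).
pose C i j := xget 0 [set C | forall x, S x -> `|evalp (mderiv i (mderiv j p)) x| <= C].
have CP i j x : S x -> `|evalp (mderiv i (mderiv j p)) x| <= C i j.
  by move: x; rewrite /C; case: xgetP => [c -> //|]; have [c hc] := H i j; move=> /(_ c hc).
exists (\sum_i \sum_j C i j) => -[x y] [/= Sx Sy].
rewrite /hess hessian_formE /=; apply: le_trans (ler_norm_sum _ _ _) _; apply: ler_sum => i _.
apply: le_trans (ler_norm_sum _ _ _) _; apply: ler_sum => j _.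
rewrite 2!normrM; apply: le_trans (CP i j x Sx); apply: ler_piMl => //.
by apply: mulr_ile1 => //; exact: sphere_coord_le1.
Qed.

Lemma integrable_SS (f : B * B -> R) : measurable_fun setT f ->
  (exists C, forall z, SS z -> `|f z| <= C) -> mu.-integrable SS (EFin \o f).
Proof.
move=> mf [C HC]; apply: measurable_bounded_integrable.
- exact: measurable_SS.
- by apply: le_lt_trans (ltry 1); rewrite le_eqVlt; apply/orP; left; apply/eqP; exact: mu_SS.
- exact: measurable_funTS.
- by exists C; split; [exact: num_real|move=> M CM x /HC /le_trans; apply; exact: ltW].
Qed.

Lemma form_sup_boundE a (p : mpoly n R) (x : 'cV[R]_n) : p \in homog a -> S x ->
  ((evalp p x ^+ 2)%:E <= ('C(n + a - 1, a))%:R%:E * \int[sigma]_(y in S) (evalp p y ^+ 2)%:E)%E.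
Proof.
move=> pa Sx.
have hE : (fun y : B => (evalp p y ^+ 2)%:E) = EFin \o (evalp (p ^+ 2) : B -> R).
  by apply/funext => y /=; rewrite /evalp rmorphXn.
have hf : (\int[sigma]_(y in S) (evalp p y ^+ 2)%:E)%E \is a fin_num.
  by rewrite hE; apply: integrable_fin_num; [exact (@measurable_sphere R n)|exact: integrable_evalp].
rewrite -(fineK hf) -EFinM lee_fin; exact: form_sup_bound.
Qed.

(** Apply form_sup_bound to the k-th power of the form, first in y with x
    fixed, then in x with y fixed under the integral; Tonelli recombines the
    two integrals. *)
Lemma hess_power_bound p k x y : S x -> S y ->
  ((hess p (x, y) ^+ (2 * k))%:E <=
   (biform_dim n d k)%:R%:E * \int[mu]_(z in SS) (hess p z ^+ (2 * k))%:E)%E.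
Proof.
move=> Sx Sy.
have [q qh qE] := hessian_form_homog_r p x.
have qk : q ^+ k \in homog (2 * k) by exact: dhomogMn.
have := form_sup_boundE qk Sy.
have E1 z : evalp (q ^+ k) z ^+ 2 = hess p (x, z) ^+ (2 * k).
  by rewrite /evalp rmorphXn -exprM mulnC /= -[meval _ q]/(evalp q z) qE.
rewrite E1; under eq_integral do rewrite E1.
move/le_trans; apply.
pose H z := (hess p z ^+ (2 * k))%:E.
have H0 z : (0 <= H z)%E by rewrite lee_fin exprM exprn_ge0 ?sqr_ge0.
have mH : measurable_fun setT H.
  apply: (measurableT_comp (@EFin_measurable R setT)).
  apply: (@measurable_funX _ (B * B)%type R); exact: measurable_hess.
have E2 y' : S y' -> (H (x, y') <= ('C(n + (2 * d - 2) * k - 1, (2 * d - 2) * k))%:R%:E *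
     \int[sigma]_(x' in S) H (x', y'))%E.
  move=> Sy'; have [r rh rE] := hessian_form_homog_l (ltnW n2) d0 p y'.
  have rk : r ^+ k \in homog ((2 * d - 2) * k) by exact: dhomogMn.
  have := form_sup_boundE rk Sx.
  have E3 z : evalp (r ^+ k) z ^+ 2 = hess p (z, y') ^+ (2 * k).
    by rewrite /evalp rmorphXn -exprM mulnC /= -[meval _ r]/(evalp r z) rE.
  by rewrite E3; under eq_integral do rewrite E3.
pose Hs := (H \_ SS).
have mHs : measurable_fun setT Hs.
  by apply/(measurable_restrictT _ _).1; [exact: measurable_SS|exact: measurable_funTS].
have Hs0 z : (0 <= Hs z)%E by rewrite /Hs patchE; case: ifP.
have HsE x' y' : Hs (x', y') = if (x' \in S) && (y' \in S) then H (x', y') else 0%E.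
  rewrite /Hs patchE; congr (if _ then _ else _).
  by apply/idP/andP => [/set_mem[]/= ? ?|[/set_mem ? /set_mem ?]]; [split; exact: mem_set|exact: mem_set].
rewrite /biform_dim natrM EFinM [X in (_ <= X * _)%E]muleC -muleA.
apply: lee_wpmul2l; first by rewrite lee_fin.
rewrite [X in (_ <= _ * X)%E]integral_mkcond.
rewrite -[X in (_ <= _ * X)%E]/(\int[mu]_z Hs z)%E.
rewrite (@fubini_tonelli2 _ _ B B R sigma sigma Hs mHs Hs0).
rewrite -ge0_integralZl_EFin//; last 2 first.
- by move=> z _; apply: integral_ge0 => x' _.
- exact: (@measurable_fun_fubini_tonelli_G _ _ B B R sigma Hs mHs Hs0).
rewrite integral_mkcond; apply: le_ge0_integral => y'; rewrite ?patchE.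
  by case: ifP => _; [exact: H0|exact: lexx].
case: ifPn => [/set_mem Sy'|_]; last first.
  by rewrite mule_ge0// ?lee_fin//; apply: integral_ge0 => x' _.
apply: le_trans (E2 _ Sy') _; apply: lee_wpmul2l; first by rewrite lee_fin.
rewrite integral_mkcond; apply: le_ge0_integral => x'; rewrite ?patchE.
  by case: ifP => _; [exact: H0|exact: lexx].
by rewrite HsE (mem_set Sy') andbT.
Qed.

Lemma biform_dim1 : biform_dim n d 1 = dim_biforms n d.
Proof.
rewrite /biform_dim /dim_biforms !muln1; congr ('C(_, _) * 'C(_, _))%N; lia.
Qed.

Lemma hess_sup_bound p x y : S x -> S y ->
  hess p (x, y) ^+ 2 <= (dim_biforms n d)%:R * hessian_prod sigma p p.
Proof.
move=> Sx Sy; have := @hess_power_bound p 1 x y Sx Sy; rewrite muln1 biform_dim1.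
have hi : mu.-integrable SS (EFin \o (fun z => hess p z ^+ 2)).
  apply: integrable_SS.
    by apply: (@measurable_funX _ (B * B)%type R); exact: measurable_hess.
  have [C HC] := hess_bounded p; exists (C ^+ 2) => z Sz.
  by rewrite normrX lerXn2r ?nnegrE ?HC//; apply: le_trans (HC z Sz).
have := integrable_fin_num measurable_SS hi => /fineK <-.
rewrite -EFinM lee_fin => /le_trans; apply.
by rewrite ler_wpM2l.
Qed.

End BiformBound.

(** * Volume of the section of convex forms *)

Section Assembly.
Context {R : realType} {n d : nat} (sigma : probability (borelRn R n) R).
Hypotheses (n2 : (2 <= n)%N) (d0 : (0 < d)%N) (hsigma : rotation_invariant_on_sphere sigma).
Context {D : nat} (e : 'I_D -> forms R n d) (he : is_basis (mean_zero_forms d sigma) e).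
Local Notation S := (unit_sphere R n).
Local Notation B := (borelRn R n).
Local Notation SS := (S `*` S : set (B * B)%type).
Local Notation mu := (sigma \x sigma)%E.
Local Notation T := (D.-tuple R).

Let n0 : (0 < n)%N := ltnW n2.

Lemma sphere_meanD (p q : forms R n d) :
  sphere_mean sigma (p + q) = sphere_mean sigma p + sphere_mean sigma q.
Proof.
rewrite /sphere_mean.
have -> : form_eval (p + q) = (fun x => form_eval p x + form_eval q x).
  by apply/funext => x; rewrite /form_eval mevalD.
by rewrite RintegralD//; [exact (@measurable_sphere R n)|exact: integrable_evalp|exact: integrable_evalp].
Qed.

Lemma sphere_meanZ (a : R) (p : forms R n d) :
  sphere_mean sigma (a *: p) = a * sphere_mean sigma p.
Proof.
rewrite /sphere_mean.
have -> : form_eval (a *: p) = (fun x => a * form_eval p x).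
  by apply/funext => x; rewrite /form_eval mevalZ.
by rewrite RintegralZl//; [exact (@measurable_sphere R n)|exact: integrable_evalp].
Qed.

Lemma lincomb_mean_zero (t : T) : mean_zero_forms d sigma (lincomb e t).
Proof. by rewrite -he.2; exists t. Qed.

Lemma lincomb_eq0 (t : T) : lincomb e t = 0 -> rowv t = 0.
Proof.
move=> t0.
have -> : t = [tuple (0 : R) | i < D].
  apply: he.1; rewrite t0 /lincomb big1// => i _.
  by rewrite tnth_mktuple scale0r.
by apply/rowP => i; rewrite !mxE tnth_mktuple.
Qed.

Lemma lincomb_affine s (a t : T) : lincomb e (affine_tuple s a t) = lincomb e a + s *: lincomb e t.
Proof.
rewrite /lincomb scaler_sumr -big_split; apply: eq_bigr => i _ /=.
by rewrite tnth_mktuple scalerDl scalerA.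
Qed.

Let bH i : B * B -> R := hess (e i).

Definition hessian_gram : 'M[R]_D := gram mu SS bH.

Lemma comb_hess (t : T) z : comb bH (rowv t) z = hess (lincomb e t) z.
Proof. by rewrite /hess hessian_form_lincomb; apply: eq_bigr => i _; rewrite mxE. Qed.

Lemma integrable_hessM (p q : forms R n d) :
  mu.-integrable SS (EFin \o (fun z => hess p z * hess q z)).
Proof.
apply: (integrable_SS hsigma).
  by apply: (@measurable_funM _ (B * B)%type R setT); exact: measurable_hess.
have [C HC] := hess_bounded p; have [C' HC'] := hess_bounded q.
by exists (C * C') => z Sz; rewrite normrM; apply: ler_pM; rewrite ?HC ?HC'.
Qed.

Lemma hessian_gramE (t : T) :
  bilin hessian_gram (rowv t) (rowv t) = hessian_prod sigma (lincomb e t) (lincomb e t).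
Proof.
rewrite -(Rintegral_combM (measurable_SS (R := R) (n := n))); last first.
  by move=> i j; exact: integrable_hessM.
by apply: eq_Rintegral => z _; rewrite !comb_hess.
Qed.

(** Strictness: a form of zero Hessian norm has, by hess_sup_bound, a Hessian
    form vanishing on pairs of unit vectors, hence is zero. *)
Lemma hessian_gram_posdef : posdef hessian_gram.
Proof.
split; first exact: gram_sym.
move=> v v0; have [t tv] := rowv_surj v.
have ge0 : 0 <= bilin hessian_gram v v.
  apply: gram_ge0; first exact: measurable_SS.
  by move=> i j; exact: integrable_hessM.
rewrite lt_neqAle ge0 andbT eq_sym; apply: contra v0 => /eqP vv.
rewrite -tv; apply/eqP; apply: lincomb_eq0; apply: (hessian_form_inj n0 d0) => x y Sx Sy.
have := hess_sup_bound n2 d0 hsigma (lincomb e t) Sx Sy.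
rewrite -hessian_gramE tv vv mulr0 => h.
by apply/eqP; rewrite -sqrf_eq0 eq_le h sqr_ge0.
Qed.

Let bL i : B -> R := form_eval (e i).

Definition l2_gram : 'M[R]_D := gram sigma S bL.

Lemma comb_form (t : T) x : comb bL (rowv t) x = form_eval (lincomb e t) x.
Proof. by rewrite form_eval_lincomb; apply: eq_bigr => i _; rewrite mxE. Qed.

Lemma integrable_formM (p q : forms R n d) :
  sigma.-integrable S (EFin \o (fun x : B => form_eval p x * form_eval q x)).
Proof.
rewrite (_ : _ \o _ = EFin \o (evalp ((p : mpoly n R) * (q : mpoly n R)) : B -> R)).
  exact: integrable_evalp.
by apply/funext => x /=; rewrite /evalp mevalM.
Qed.

Lemma l2_gramE (t : T) :
  bilin l2_gram (rowv t) (rowv t) = \int[sigma]_(x in S) (form_eval (lincomb e t) x ^+ 2).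
Proof.
rewrite -(Rintegral_combM (@measurable_sphere R n)); last first.
  by move=> i j; exact: integrable_formM.
by apply: eq_Rintegral => z _; rewrite !comb_form expr2.
Qed.

Lemma l2_gram_posdef : posdef l2_gram.
Proof.
split; first exact: gram_sym.
move=> v v0; have [t tv] := rowv_surj v.
have ge0 : 0 <= bilin l2_gram v v.
  apply: gram_ge0; first exact (@measurable_sphere R n).
  by move=> i j; exact: integrable_formM.
rewrite lt_neqAle ge0 andbT eq_sym; apply: contra v0 => /eqP vv.
rewrite -tv; apply/eqP; apply: lincomb_eq0; apply/val_inj => /=.
apply: (evalp_sphere_inj n0 (formsP (lincomb e t))) => x Sx.
have := form_sup_bound n2 hsigma (formsP (lincomb e t)) Sx.
rewrite -[X in _ <= _ * X]l2_gramE tv vv mulr0 => h.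
by apply/eqP; rewrite -sqrf_eq0 eq_le h sqr_ge0.
Qed.

(** For a nonnegative p of mean 1, the L2 norm squared A is at most the sup
    of p, which is at most sqrt(N A) by form_sup_bound; so A <= N. *)
Lemma nonneg_form_l2_bound (p : forms R n d) : (forall x, 0 <= form_eval p x) ->
  sphere_mean sigma p = 1 ->
  \int[sigma]_(x in S) (form_eval p x ^+ 2) <= 'C(n + 2 * d - 1, 2 * d)%:R.
Proof.
move=> p0 p1; set A := \int[sigma]_(x in S) _; set N := _%:R.
have A0 : 0 <= A by apply: Rintegral_ge0 => x _; exact: sqr_ge0.
have N0 : 0 <= N by rewrite /N ler0n.
have pb x : S x -> form_eval p x <= Num.sqrt (N * A).
  move=> Sx; rewrite -(ger0_norm (p0 x)) -sqrtr_sqr ler_wsqrtr//.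
  exact: (form_sup_bound n2 hsigma (formsP p) Sx).
have : A <= Num.sqrt (N * A).
  apply: (@le_trans _ _ (\int[sigma]_(x in S) (Num.sqrt (N * A) * form_eval p x))).
    apply: le_Rintegral; first exact (@measurable_sphere R n).
    - exact: integrable_formM.
    - rewrite (_ : _ \o _ = EFin \o (evalp (Num.sqrt (N * A) *: (p : mpoly n R)) : B -> R)).
        exact: integrable_evalp.
      by apply/funext => x /=; rewrite /evalp mevalZ.
    - by move=> x Sx; rewrite expr2 ler_wpM2r// pb.
  rewrite RintegralZl//; [|exact (@measurable_sphere R n)|exact: integrable_evalp].
  by rewrite -[X in _ * X]/(sphere_mean sigma p) p1 mulr1.
rewrite -[leLHS](ger0_norm A0) -sqrtr_sqr ler_sqrt ?mulr_ge0// expr2 => h.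
by move: A0; rewrite le_eqVlt => /predU1P[<-//|A0]; move: h; rewrite ler_pM2r.
Qed.

Variables (p1 : forms R n d) (hp1 : mean_one_forms d sigma p1).

Let K : set T := [set t | convex_forms d sigma (p1 + lincomb e t)].

(** Needed because fine sends an infinite volume to 0. Convex forms are
    nonnegative, so those of mean 1 are bounded in L2 norm, and their
    coordinates lie in a cube. *)
Lemma convex_forms_volume_fin : (lebesgue_tuple K < +oo)%E.
Proof.
pose C := 2 * 'C(n + 2 * d - 1, 2 * d)%:R + 2 * \int[sigma]_(x in S) (form_eval p1 x ^+ 2).
have [r r0 Hr] := ellipsoid_bounded l2_gram_posdef C.
apply: (@le_lt_trans _ _ (lebesgue_tuple [set t : T | forall i, `|tnth t i| <= r])); last first.
  by rewrite lebesgue_tuple_box// ltry.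
apply: le_lebesgue_tuple => t [/= m1 cv]; apply: Hr.
rewrite l2_gramE.
set q := lincomb e t in m1 cv *.
have p0 := convex_form_ge0 d0 cv.
have := nonneg_form_l2_bound p0 m1.
have i1 := integrable_formM (p1 + q) (p1 + q); have i2 := integrable_formM p1 p1.
have mS := @measurable_sphere R n.
have i3 a b : sigma.-integrable S (EFin \o (fun x : B =>
    a * (form_eval (p1 + q) x * form_eval (p1 + q) x) +
    b * (form_eval p1 x * form_eval p1 x))).
  rewrite (_ : _ \o _ = EFin \o
    (evalp (a *: ((p1 + q : mpoly n R) * (p1 + q : mpoly n R)) +
            b *: ((p1 : mpoly n R) * (p1 : mpoly n R))) : B -> R)).
    exact: integrable_evalp.
  by apply/funext => x /=; rewrite /evalp mevalD !mevalZ !mevalM.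
have : \int[sigma]_(x in S) (form_eval q x ^+ 2) <=
   \int[sigma]_(x in S) (2 * (form_eval (p1 + q) x * form_eval (p1 + q) x) +
     2 * (form_eval p1 x * form_eval p1 x)).
  apply: le_Rintegral => //; first exact: integrable_formM.
  move=> x Sx.
  have -> : form_eval q x = form_eval (p1 + q) x - form_eval p1 x.
    by rewrite /form_eval mevalD addrC addKr.
  set u := form_eval _ x; set w := form_eval _ x.
  by have := sqr_ge0 (u + w); nra.
rewrite RintegralD//; last 2 first.
- by have := i3 2 0; under eq_fun do rewrite mul0r addr0.
- by have := i3 0 2; under eq_fun do rewrite mul0r add0r.
rewrite !RintegralZl// => h1 h2; apply: le_trans h1 _.
by apply: lerD => //; rewrite ler_wpM2l.
Qed.

(** Extending the Hessian forms by zero outside pairs of unit vectors turns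
    integrals over that set into integrals over the whole space, and keeps
    the inequality b_le true everywhere. *)
Let b (z : B * B) : 'rV[R]_D := \row_i (hess (e i) z * \1_SS z).

Let bE (t : T) z : (rowv t *m (b z)^T) 0 0 = hess (lincomb e t) z * \1_SS z.
Proof.
rewrite mxE /hess hessian_form_lincomb mulr_suml; apply: eq_bigr => i _.
by rewrite !mxE mulrA.
Qed.

Let b_le z v : ((v *m (b z)^T) 0 0) ^+ 2 <= (dim_biforms n d)%:R * bilin hessian_gram v v.
Proof.
have [t <-] := rowv_surj v; rewrite bE hessian_gramE indicE.
have [Sz|nSz] := pselect (SS z).
  rewrite mem_set// mulr1; case: z Sz => x y [/= Sx Sy].
  exact: hess_sup_bound.
rewrite memNset// mulr0 expr0n /= -hessian_gramE mulr_ge0//.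
exact: posdef_ge0 hessian_gram_posdef.
Qed.

Let mb i : measurable_fun setT (fun z => b z 0 i).
Proof.
rewrite (_ : (fun _ => _) = fun z => hess (e i) z * \1_SS z); last first.
  by apply/funext => z; rewrite mxE.
apply: (@measurable_funM _ (B * B)%type R setT); first exact: measurable_hess.
by apply: measurable_indic; exact: measurable_SS.
Qed.

Let musf : {sigma_finite_measure set (B * B)%type -> \bar R} :=
  product_subprobability ((sigma : subprobability B R), (sigma : subprobability B R)).

Lemma hess_le_power_integral (t : T) (k : nat) x y : S x -> S y ->
  ((hess (lincomb e t) (x, y) ^+ (2 * k))%:E <=
   (biform_dim n d k)%:R%:E * power_integral musf b k t)%E.
Proof.
move=> Sx Sy.
apply: le_trans (hess_power_bound n2 d0 hsigma (lincomb e t) k Sx Sy) _.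
apply: lee_wpmul2l; first by rewrite lee_fin.
rewrite integral_mkcond /power_integral; apply: le_ge0_integral => z; rewrite patchE.
  by case: ifP => _; rewrite lee_fin// exprM exprn_ge0 ?sqr_ge0.
rewrite bE; case: ifPn => [/set_mem Sz|_].
  by rewrite indicE mem_set// mulr1.
by rewrite lee_fin exprM exprn_ge0 ?sqr_ge0.
Qed.

Lemma radial_mean : sphere_mean sigma (radial : forms R n d) = 1.
Proof.
have [h1 _] := hsigma.
transitivity (\int[sigma]_(x in S) (1 : R)).
  by apply: eq_Rintegral => x /set_mem Sx; rewrite radialE Sx expr1n.
rewrite (Rintegral_cst sigma (@measurable_sphere R n)) mul1r -[RHS]/(fine 1%E).
by congr fine; exact: h1.
Qed.

Lemma radial_shift : exists t0 : T, p1 + lincomb e t0 = (radial : forms R n d).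
Proof.
have : range (lincomb e) ((radial : forms R n d) - p1).
  rewrite he.2 /mean_zero_forms /=.
  rewrite -[(radial : forms R n d) - p1]/((radial : forms R n d) + - p1) -scaleN1r.
  by rewrite sphere_meanD sphere_meanZ radial_mean hp1 mulN1r subrr.
by move=> [t0 _ t0E]; exists t0; rewrite t0E addrC subrK.
Qed.

(** The Hessian form of the radial form is at least 2d on pairs of unit
    vectors, which absorbs that of the perturbation. *)
Lemma convex_near_radial (t0 t : T) (s : R) :
  p1 + lincomb e t0 = (radial : forms R n d) -> 0 <= s ->
  (forall x y, S x -> S y -> s * `|hess (lincomb e t) (x, y)| <= (2 * d)%:R) ->
  K (affine_tuple s t0 t).
Proof.
move=> t0E s0 H; rewrite /K /= lincomb_affine addrA t0E; split.
  rewrite /mean_one_forms /= sphere_meanD sphere_meanZ radial_mean.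
  by rewrite (lincomb_mean_zero t) mulr0 addr0.
apply: (hessian_ge0_convex n0) => // x y Sx Sy.
rewrite hessian_formD hessian_formZ.
have h1 := radial_hessian d0 Sx Sy.
have h2 := H x y Sx Sy.
have h3 : - (s * `|hess (lincomb e t) (x, y)|) <= s * hessian_form (lincomb e t) x y.
  by rewrite -mulrN ler_wpM2l// lerNl -normrN ler_norm.
lra.
Qed.

(** The least integer above n ln(2d + 1): large enough for (2d + 1)^n <= e^k,
    and at most twice n ln(2d + 1). *)
Let k := (Num.truncn (n%:R * ln (2 * d%:R + 1) : R)).+1.
Let s : R := convex_volume_bound n d D (dim_biforms n d) * (Num.sqrt 2 * expR 2^-1).

(** On the sublevel set of the power integral, hess_power_bound bounds the
    sup of the Hessian form; the dilation factor s is chosen so that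
    numeric_bound brings it down to 2d, where convex_near_radial applies. *)
Lemma volume_ratio_bound : (1 < D)%N ->
  ((s ^+ D * (expR (- (D%:R / 2)) / 2))%:E *
     lebesgue_tuple [set t | (bilin hessian_gram (rowv t) (rowv t) <= 1)%R] <=
   lebesgue_tuple K)%E.
Proof.
move=> D1.
pose L : R := ln (2 * d%:R + 1).
have L2 : 2^-1 <= L by exact: ln_ge_half.
have Dbi0 := dim_biforms_gt0 n2 d0.
have nL1 : 1 <= n%:R * L.
  have : (2 : R) <= n%:R by rewrite ler_nat.
  by nra.
have nL0 : 0 <= n%:R * L by apply: le_trans nL1.
have kL : n%:R * L <= k%:R by apply: ltW; exact: truncnS_gt.
have kU : k%:R <= 2 * n%:R * L.
  have h : (Num.truncn (n%:R * L))%:R <= n%:R * L by rewrite truncn_le.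
  by rewrite /k -/L -natr1 -mulrA; lra.
have D0 : (0 < D)%N by exact: ltnW.
have fb0 := @convex_volume_bound_gt0 R n d n2 d0 D (dim_biforms n d) D0 Dbi0.
have s0 : 0 < s by exact: mulr_gt0.
have [t0 t0E] := radial_shift.
have c0 : 0 < D%:R / 2 :> R by rewrite divr_gt0 ?ltr0n.
have M0 : 0 < (dim_biforms n d)%:R :> R by rewrite ltr0n.
have muT : (musf setT <= 1)%E by exact: sprobability_setT.
apply: (volume_lower_bound hessian_gram_posdef mb muT c0 M0 (ltn0Sn _) b_le (k := k) s0 (t0 := t0)).
move=> t tl; apply: (convex_near_radial t0E (ltW s0)) => x y Sx Sy.
have := hess_le_power_integral t k Sx Sy.
set h := hess _ _; set lam := (X in (_ <= X%:E)%E) in tl.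
move=> /le_trans /(_ (lee_wpmul2l _ tl)); rewrite lee_fin ler0n => /(_ isT).
rewrite -EFinM lee_fin => hk.
have := numeric_bound n2 d0 D0 Dbi0 kL kU; rewrite -/s -/lam => num.
have sh0 : 0 <= s * `|h| by rewrite mulr_ge0// ltW.
have d2 : 0 <= (2 * d)%:R :> R by rewrite ler0n.
rewrite -(@ler_pXn2r _ (2 * k))//.
rewrite exprMn -normrX (@ger0_norm _ (h ^+ (2 * k))); last by rewrite exprM exprn_ge0 ?sqr_ge0.
rewrite natrM; apply: le_trans num; rewrite ler_wpM2l//.
by rewrite exprn_ge0// ltW.
Qed.

End Assembly.

Theorem theorem1p2 (R : realType) (n d : nat) (hn : (2 <= n)%N) (hd : (1 <= d)%N)
    (sigma : probability (borelRn R n) R)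
    (hsigma : rotation_invariant_on_sphere sigma)
    (e : 'I_(dim_mean_zero n d) -> forms R n d)
    (he : is_basis (mean_zero_forms d sigma) e)
    (p1 : forms R n d) (hp1 : mean_one_forms d sigma p1) :
  (volume e p1 (convex_forms d sigma)
     / volume e 0 (hessian_ball d sigma)) `^ ((dim_mean_zero n d)%:R^-1)
  >= 2 * d%:R / (9 * expR 1 ^+ 2 * Num.sqrt (2 * n%:R * ln (2 * d%:R + 1)))
     * Num.sqrt ((dim_mean_zero n d)%:R / (dim_biforms n d)%:R).
Proof.
have D1 := dim_mean_zero_gt1 hn hd.
have Dbi0 := dim_biforms_gt0 hn hd.
have f0 : 0 < convex_volume_bound n d (dim_mean_zero n d) (dim_biforms n d) :> R.
  exact: (convex_volume_bound_gt0 hn hd (ltnW D1) Dbi0).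
rewrite -[leLHS]/(convex_volume_bound n d (dim_mean_zero n d) (dim_biforms n d)).
apply: (root_lower_bound D1 f0).
have pG := hessian_gram_posdef hn hd hsigma he.
have ballE : [set t : (dim_mean_zero n d).-tuple R | hessian_ball d sigma (0 + lincomb e t)] =
    [set t | bilin (hessian_gram sigma e) (rowv t) (rowv t) <= 1].
  apply/seteqP; split => t /=; rewrite /hessian_ball add0r hessian_gramE//; first by case.
  by move=> h; split => //; exact: lincomb_mean_zero.
rewrite /volume ballE.
have := volume_ratio_bound hn hd hsigma he hp1 D1.
have := convex_forms_volume_fin hn hd hsigma he p1.
have := ellipsoid_gt0 (hessian_gram sigma e); have := ellipsoid_pinfty pG.
set VS := lebesgue_tuple [set t | bilin _ _ _ <= 1]; set VK := lebesgue_tuple _.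
move=> VSf VS0 VKf.
have VS_fin : VS \is a fin_num by rewrite ge0_fin_numE// ltW.
have VK_fin : VK \is a fin_num by rewrite ge0_fin_numE//; exact: lebesgue_tuple_ge0.
rewrite -{1}(fineK VS_fin) -{1}(fineK VK_fin) -EFinM lee_fin.
by rewrite -ler_pdivlMr// fine_gt0// VS0.
Qed.
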